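(* Let $\mathbf{k}$ be an algebraically closed field and let $X$ be an affine variety over $\mathbf{k}$. Let $V$ be a commutative irreducible algebraic subvariety of $\mathrm{Aut}(X)$ containing the identity. Then the subgroup $\langle V\rangle$ of $\mathrm{Aut}(X)$ generated by $V$ is an algebraic subgroup of $\mathrm{Aut}(X)$.
   Context: A subset $V$ of a group is commutative if $fg=gf$ for all $f,g\in V$. Ind-group structure on $\mathrm{Aut}(X)$: fix a closed embedding $X\hookrightarrow\mathbb{A}^N_{\mathbf{k}}$. An automorphism $f$ of $X$ has degree $\le d$ if there are polynomials $f_1,\dots,f_N$ of degree $\le d$ with $f(\mathbf{x})=(f_1(\mathbf{x}),\dots,f_N(\mathbf{x}))$ for $\mathbf{x}\in X$; $\deg(f)$ is the smallest such $d$. Set $\mathrm{Aut}(X)_d=\{f\in \mathrm{Aut}(X): \max(\deg f,\deg f^{-1})\le d\}$. Identifying $f$ with the pair $(f,f^{-1})$, $\mathrm{Aut}(X)_d$ is an affine algebraic variety, namely a closed subset of the finite-dimensional vector space of pairs of $N$-tuples of elements of $\mathcal{O}(X)$ represented by polynomials of degree $\le d$. The inclusions $\mathrm{Aut}(X)_d\subset \mathrm{Aut}(X)_{d+1}$ are closed immersions and $\mathrm{Aut}(X)=\bigcup_d\mathrm{Aut}(X)_d$; this makes $\mathrm{Aut}(X)$ an ind-group. A subset $S\subset \mathrm{Aut}(X)$ is closed if $S\cap \mathrm{Aut}(X)_d$ is Zariski closed in $\mathrm{Aut}(X)_d$ for every $d$. An algebraic subvariety (or algebraic subset) of $\mathrm{Aut}(X)$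 is a closed subset contained in some $\mathrm{Aut}(X)_d$; an algebraic subgroup is a subgroup which is an algebraic subvariety. These notions do not depend on the embedding. *)

(* Defs.v *)
From HB Require Import structures.
From mathcomp Require Import all_boot all_order all_algebra.
From mathcomp Require Import boolp classical_sets.
From mathcomp Require Import mpoly.

Set Implicit Arguments.
Unset Strict Implicit.
Unset Printing Implicit Defensive.

Import GRing.Theory.
Local Open Scope ring_scope.
Local Open Scope classical_set_scope.

(* Points of affine n-space are row vectors; [x ord0 : 'I_n -> k] is the
   underlying family of coordinates. *)
Definition zero_locus (k : fieldType) (n : nat) (I : set {mpoly k[n]}) :
  set 'rV[k]_n := [set x | forall p, I p -> p.@[x ord0] = 0].

Definition zariski_closed (k : fieldType) (n : nat) (Z : set 'rV[k]_n) : Prop :=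
  exists I : set {mpoly k[n]}, Z = zero_locus I.

Section Automorphisms.
Variables (k : fieldType) (N : nat) (X : set 'rV[k]_N).
Implicit Types (phi psi : X -> X) (d : nat).

Definition represents (P : 'I_N -> {mpoly k[N]}) phi : Prop :=
  forall (x : X) (i : 'I_N), val (phi x) ord0 i = (P i).@[val x ord0].

Definition regular_map phi : Prop := exists P, represents P phi.

Record aut : Type := Aut {
  aut_fun :> X -> X;
  aut_inv : X -> X;
  aut_funK : cancel aut_fun aut_inv;
  aut_invK : cancel aut_inv aut_fun;
  aut_fun_regular : regular_map aut_fun;
  aut_inv_regular : regular_map aut_inv }.

Lemma aut_eq (f g : aut) : aut_fun f = aut_fun g -> f = g.
Proof.
case: f g => [f f' fK f'K rf rf'] [g g' gK g'K rg rg'] /= efg.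
have efg' : f' = g' by apply/funext => x; rewrite -[LHS]gK -efg f'K.
by subst; congr Aut; apply: Prop_irrelevance.
Qed.

Lemma regular_map_id : regular_map id.
Proof. by exists (fun i => 'X_i) => x i; rewrite mevalXU. Qed.

Lemma regular_map_comp phi psi :
  regular_map phi -> regular_map psi -> regular_map (phi \o psi).
Proof.
move=> [P hP] [Q hQ]; exists (fun i => P i \mPo [tuple Q j | j < N]) => x i.
rewrite comp_mpoly_meval /= hP; apply: meval_eq => j.
by rewrite hQ tnth_map tnth_ord_tuple.
Qed.

Definition aut_one : aut :=
  @Aut id id (fun=> erefl) (fun=> erefl) regular_map_id regular_map_id.

Definition aut_mul (f g : aut) : aut :=
  @Aut (f \o g) (aut_inv g \o aut_inv f)
    (can_comp (@aut_funK f) (@aut_funK g))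
    (can_comp (@aut_invK g) (@aut_invK f))
    (regular_map_comp (aut_fun_regular f) (aut_fun_regular g))
    (regular_map_comp (aut_inv_regular g) (aut_inv_regular f)).

Definition aut_invg (f : aut) : aut :=
  @Aut (aut_inv f) f (@aut_invK f) (@aut_funK f)
    (aut_inv_regular f) (aut_fun_regular f).

Lemma aut_mulA : associative aut_mul.
Proof. by move=> f g h; apply: aut_eq. Qed.

Lemma aut_mul1 : left_id aut_one aut_mul.
Proof. by move=> f; apply: aut_eq. Qed.

Lemma aut_mulr1 : right_id aut_one aut_mul.
Proof. by move=> f; apply: aut_eq. Qed.

Lemma aut_mulV : left_inverse aut_one aut_invg aut_mul.
Proof. by move=> f; apply: aut_eq; apply/funext => x /=; rewrite aut_funK. Qed.

Lemma aut_mulrV : right_inverse aut_one aut_invg aut_mul.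
Proof. by move=> f; apply: aut_eq; apply/funext => x /=; rewrite aut_invK. Qed.

HB.instance Definition _ := gen_eqMixin aut.
HB.instance Definition _ := gen_choiceMixin aut.
HB.instance Definition _ :=
  isGroup.Build aut aut_mulA aut_mul1 aut_mulr1 aut_mulV aut_mulrV.

(* [msize p] is one more than the degree of [p] (and 0 if [p = 0]). *)
Definition degree_le d phi : Prop :=
  exists2 P, (forall i, (msize (P i) <= d.+1)%N) & represents P phi.

Definition aut_le d : set aut :=
  [set f : aut | degree_le d f /\ degree_le d (f^-1)%g].

(* The elements of the finite-dimensional vector space O(X)_{<= d}. *)
Definition regular_fun_le d : set (X -> k) :=
  [set u | exists2 p : {mpoly k[N]},
     (msize p <= d.+1)%N & forall x : X, u x = p.@[val x ord0]].

Definition regular_fun_basis d (m : nat) (e : 'I_m -> X -> k) : Prop :=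
  [/\ forall j, regular_fun_le d (e j),
      forall c : 'rV[k]_m,
        (forall x, \sum_j c ord0 j * e j x = 0) -> c = 0
    & forall u, regular_fun_le d u ->
        exists c : 'rV[k]_m, forall x, u x = \sum_j c ord0 j * e j x].

(* [A] is the matrix whose i-th row lists the coordinates, in the basis [e],
   of the i-th component of [phi]. *)
Definition coordinates (m : nat) (e : 'I_m -> X -> k) phi (A : 'M[k]_(N, m)) :
  Prop := forall (x : X) (i : 'I_N),
    val (phi x) ord0 i = \sum_j A i j * e j x.

(* S :&: Aut(X)_d is Zariski closed in Aut(X)_d, the latter being embedded by
   f |-> (f, f^-1) in the vector space of pairs of N-tuples of elements of
   O(X)_{<= d}, itself identified with an affine space by means of a basis of
   O(X)_{<= d}; the condition does not depend on this basis. *)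
Definition closed_in_aut_le d (S : set aut) : Prop :=
  exists (m : nat) (e : 'I_m -> X -> k), regular_fun_basis d e /\
  exists2 Z : set 'rV[k]_((N + N) * m), zariski_closed Z &
    forall (f : aut) (A B : 'M[k]_(N, m)), aut_le d f ->
      coordinates e f A -> coordinates e (f^-1)%g B ->
      (S f <-> Z (mxvec (col_mx A B))).

Definition aut_closed (S : set aut) : Prop := forall d, closed_in_aut_le d S.

Definition algebraic_subset (S : set aut) : Prop :=
  aut_closed S /\ exists d, S `<=` aut_le d.

Definition irreducible_subset (S : set aut) : Prop :=
  S !=set0 /\
  forall F G : set aut, aut_closed F -> aut_closed G ->
    S `<=` F `|` G -> S `<=` F \/ S `<=` G.

End Automorphisms.

Definition commutative_subset (G : groupType) (S : set G) : Prop :=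
  forall f g, S f -> S g -> (f * g = g * f)%g.

Definition subgroup (G : groupType) (S : set G) : Prop :=
  [/\ S 1%g, forall f g, S f -> S g -> S (f * g)%g
    & forall f, S f -> S (f^-1)%g].

Definition subgroup_generated (G : groupType) (S : set G) : set G :=
  smallest (@subgroup G) S.

Definition algebraic_subgroup (k : fieldType) (N : nat) (X : set 'rV[k]_N)
  (S : set (aut X)) : Prop := subgroup S /\ algebraic_subset S.

(* Main.v *)
(* Let [Gamma] be the group generated by [V], and [word V n] the set of products
   of [n] elements [v w^-1] with [v], [w] in [V].  These sets increase, they are
   irreducible, and their union is [Gamma].

   Bounded degree.  For a point [y] the closures of the [word V n y] stabilize at
   [n = N], by dimension.  Since [Gamma] is commutative this bounds, uniformly
   in [y], the rank of the function [(g, h) |-> x_i (g h y)] on [Gamma * Gamma].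
   On an irreducible closed subset [Y] of [X], an ultrapower [L] of [k] over [Y]
   (an algebraically closed field that contains the coordinate ring of [Y])
   turns [g |-> x_i (g y)] into a matrix coefficient of a representation of
   [Gamma] on [L^n].  Being commutative it is triangularizable.  A diagonal
   character [chi] and its inverse are both algebraic families on the irreducible
   [V]; every valuation of [L] over [k] is generically minimal on both, hence is
   constant and equal to its value 0 at the identity, so that [chi] takes its
   values in [k].  Therefore the coefficients of all elements of [Gamma] lie in a
   finite-dimensional [k]-subspace of [L], and Noetherian induction on [Y] bounds
   the degree on [X].

   Closedness.  [Gamma] is now determined by its values at finitely many points.
   By quantifier elimination some [word V n] contains a nonempty open subset of
   the closure of [Gamma], which is a group, so the closure is [Gamma]. *)

From HB Require Import structures.
Require Import Defs.
From mathcomp Require Import all_boot all_order all_algebra all_field.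
From mathcomp Require Import boolp classical_sets filter.
From mathcomp Require Import mpoly.
From mathcomp Require Import ring.

Set Implicit Arguments.
Unset Strict Implicit.
Unset Printing Implicit Defensive.

Import GRing.Theory Order.TTheory.
Local Open Scope ring_scope.
Local Open Scope classical_set_scope.
Local Open Scope quotient_scope.

(** Irreducibility is the crux. On the product of the punctured line and the line, the identity and
    [(x, y) |-> (x, x y)] form a commutative closed set, but the powers [(x, x ^ n y)] have
    unbounded degree: the character [x] is not a scalar. The irreducible [V] must be shown to force
    such characters into [k], and valuations of an overfield detect this.

    An ultrapower serves as overfield because the rank bound is obtained one point at a time, with
    coefficients that depend on the point in no regular way: it accepts arbitrary functions on [X].
    It is algebraically closed because equations can be solved pointwise, so triangularization is
    available at once.

    Dimension is never defined. Chains of irreducible sets are bounded by comparing a count of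
    independent polynomials of bounded degree with a count of monomials. Similarly, closed subsets
    of the automorphism group are handled through polynomials in the values of [f] and [f^-1] at
    points, which involve no degree filtration. *)

Section LinearAlgebra.
Variable F : fieldType.

(** An independent family of values has at most [n] members, so a longest one exists and spans. The
    basis consists of values at members of [S]; this is how finitely many points of [X] or elements
    of the group get selected. *)
Lemma exists_row_basis (T : Type) (S : set T) (n : nat) (phi : T -> 'rV[F]_n) :
  exists (r : nat) (t : 'I_r -> T),
    [/\ forall i, S (t i), row_free (\matrix_(i < r) phi (t i))
      & forall x, S x -> (phi x <= \matrix_(i < r) phi (t i))%MS].
Proof.
pose P r := `[< exists t : 'I_r -> T,
  (forall i, S (t i)) /\ row_free (\matrix_(i < r) phi (t i)) >].
have exP : exists r, P r.
  exists 0; apply/asboolP.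
  by exists (fun i : 'I_0 => match i with Ordinal m h =>
      False_rect _ (notF h) end); split; [case | rewrite /row_free mxrank.unlock].
have ubP r : P r -> (r <= n)%N.
  by move=> /asboolP [t [_ /eqP <-]]; exact: rank_leq_col.
case: (ex_maxnP exP ubP) => r /asboolP [t [St ft]] maxr.
exists r, t; split=> // x Sx; apply: contraT => nx.
pose t' (i : 'I_r.+1) := oapp t x (unlift ord0 i).
suff /maxr : P r.+1 by rewrite ltnn.
apply/asboolP; exists t'; split.
  by move=> i; rewrite /t'; case: unliftP => [j|] _ /=.
set A := \matrix_i _ in ft nx; set B := \matrix_i _.
have AB : (A <= B)%MS.
  apply/row_subP => i; rewrite rowK.
  by rewrite (_ : phi (t i) = row (lift ord0 i) B) ?row_sub // rowK /t' liftK.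
have xB : (phi x <= B)%MS.
  by rewrite (_ : phi x = row ord0 B) ?row_sub // rowK /t' unlift_none.
rewrite -row_leq_rank; rewrite -row_leq_rank in ft.
have : (A < B)%MS.
  by rewrite ltmxE AB /=; apply: contra nx => /(submx_trans xB).
rewrite ltmxErank => /andP[_]; exact: leq_ltn_trans.
Qed.

End LinearAlgebra.

(** * Ultrapowers of an algebraically closed field *)

Section Ultrapower.
Variables (k : closedFieldType) (T : Type) (U : set_system T).
Hypothesis UU : UltraFilter U.

Definition ultra_equiv (f g : T -> k) : bool := `[< U [set x | f x = g x] >].

Lemma ultra_equiv_refl : reflexive ultra_equiv.
Proof. by move=> f; apply/asboolP; apply: filterS filterT => x. Qed.

Lemma ultra_equiv_sym : ssrbool.symmetric ultra_equiv.
Proof. by move=> f g; apply/asboolP/asboolP; apply: filterS => x /= ->. Qed.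

Lemma ultra_equiv_trans : transitive ultra_equiv.
Proof.
move=> g f h /asboolP fg /asboolP gh; apply/asboolP.
by apply: filterS (filterI fg gh) => x [/= -> ->].
Qed.

Canonical ultra_equiv_canonical :=
  EquivRel ultra_equiv ultra_equiv_refl ultra_equiv_sym ultra_equiv_trans.

Definition ultrapower := {eq_quot ultra_equiv}.
HB.instance Definition _ := EqQuotient.on ultrapower.
HB.instance Definition _ := Choice.on ultrapower.

Definition ultra_class (f : T -> k) : ultrapower := \pi_ultrapower f.

Lemma ultra_classP (f g : T -> k) :
  ultra_class f = ultra_class g <-> U [set x | f x = g x].
Proof.
split=> [/eqquotP /asboolP //|fg].
by apply/eqquotP; apply/asboolP.
Qed.

Lemma ultra_repr (f : T -> k) :
  U [set x | repr (ultra_class f) x = f x].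
Proof. by apply/ultra_classP; rewrite /ultra_class reprK. Qed.

Lemma ultra_class_surj (a : ultrapower) : exists f, a = ultra_class f.
Proof. by exists (repr a); rewrite /ultra_class reprK. Qed.

Definition ultra_add (a b : ultrapower) :=
  ultra_class (fun x => repr a x + repr b x).
Definition ultra_mul (a b : ultrapower) :=
  ultra_class (fun x => repr a x * repr b x).
Definition ultra_opp (a : ultrapower) := ultra_class (fun x => - repr a x).
Definition ultra_inv (a : ultrapower) := ultra_class (fun x => (repr a x)^-1).

Lemma ultra_addE f g :
  ultra_add (ultra_class f) (ultra_class g) = ultra_class (fun x => f x + g x).
Proof.
apply/ultra_classP.
by apply: filterS (filterI (ultra_repr f) (ultra_repr g)) => x [/= -> ->].
Qed.

Lemma ultra_mulE f g :
  ultra_mul (ultra_class f) (ultra_class g) = ultra_class (fun x => f x * g x).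
Proof.
apply/ultra_classP.
by apply: filterS (filterI (ultra_repr f) (ultra_repr g)) => x [/= -> ->].
Qed.

Lemma ultra_oppE f : ultra_opp (ultra_class f) = ultra_class (fun x => - f x).
Proof. by apply/ultra_classP; apply: filterS (ultra_repr f) => x /= ->. Qed.

Lemma ultra_invE f :
  ultra_inv (ultra_class f) = ultra_class (fun x => (f x)^-1).
Proof. by apply/ultra_classP; apply: filterS (ultra_repr f) => x /= ->. Qed.

Let ultraE := (ultra_addE, ultra_mulE, ultra_oppE, ultra_invE).

Lemma ultra_addA : associative ultra_add.
Proof.
move=> a b c; have [f ->] := ultra_class_surj a.
have [g ->] := ultra_class_surj b; have [h ->] := ultra_class_surj c.
by rewrite !ultraE; congr ultra_class; apply/funext => x; rewrite addrA.
Qed.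

Lemma ultra_addC : commutative ultra_add.
Proof.
move=> a b; have [f ->] := ultra_class_surj a.
have [g ->] := ultra_class_surj b.
by rewrite !ultraE; congr ultra_class; apply/funext => x; rewrite addrC.
Qed.

Lemma ultra_add0 : left_id (ultra_class (fun=> 0)) ultra_add.
Proof.
move=> a; have [f ->] := ultra_class_surj a.
by rewrite !ultraE; congr ultra_class; apply/funext => x; rewrite add0r.
Qed.

Lemma ultra_addN : left_inverse (ultra_class (fun=> 0)) ultra_opp ultra_add.
Proof.
move=> a; have [f ->] := ultra_class_surj a.
by rewrite !ultraE; congr ultra_class; apply/funext => x; rewrite addNr.
Qed.

HB.instance Definition _ := GRing.isZmodule.Build ultrapower
  ultra_addA ultra_addC ultra_add0 ultra_addN.

Lemma ultra_mulA : associative ultra_mul.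
Proof.
move=> a b c; have [f ->] := ultra_class_surj a.
have [g ->] := ultra_class_surj b; have [h ->] := ultra_class_surj c.
by rewrite !ultraE; congr ultra_class; apply/funext => x; rewrite mulrA.
Qed.

Lemma ultra_mulC : commutative ultra_mul.
Proof.
move=> a b; have [f ->] := ultra_class_surj a.
have [g ->] := ultra_class_surj b.
by rewrite !ultraE; congr ultra_class; apply/funext => x; rewrite mulrC.
Qed.

Lemma ultra_mul1 : left_id (ultra_class (fun=> 1)) ultra_mul.
Proof.
move=> a; have [f ->] := ultra_class_surj a.
by rewrite !ultraE; congr ultra_class; apply/funext => x; rewrite mul1r.
Qed.

Lemma ultra_mulDl : left_distributive ultra_mul ultra_add.
Proof.
move=> a b c; have [f ->] := ultra_class_surj a.
have [g ->] := ultra_class_surj b; have [h ->] := ultra_class_surj c.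
by rewrite !ultraE; congr ultra_class; apply/funext => x; rewrite mulrDl.
Qed.

Lemma ultra_one_neq0 : ultra_class (fun=> 1) != ultra_class (fun=> 0).
Proof.
apply/eqP => /ultra_classP U0; apply: (filter_not_empty U).
by apply: filterS U0 => x /= /eqP; rewrite oner_eq0.
Qed.

HB.instance Definition _ := GRing.Zmodule_isComNzRing.Build ultrapower
  ultra_mulA ultra_mulC ultra_mul1 ultra_mulDl ultra_one_neq0.

(** Maximality of the filter gives the field axiom: the zero set of [f] or its complement is in [U],
    so a nonzero class is invertible almost everywhere. *)
Lemma ultra_mulV (a : ultrapower) : a != 0 -> ultra_mul (ultra_inv a) a = 1.
Proof.
have [f ->] := ultra_class_surj a => /eqP nf0; rewrite !ultraE.
apply/ultra_classP; have [U0|] := in_ultra_setVsetC [set x | f x = 0] UU.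
  by case: nf0; apply/ultra_classP.
by apply: filterS => x /= /eqP fx0; rewrite mulVf.
Qed.

Lemma ultra_inv0 : ultra_inv 0 = 0.
Proof.
rewrite [0]/(ultra_class (fun=> 0)) ultraE; congr ultra_class.
by apply/funext => x; rewrite invr0.
Qed.

HB.instance Definition _ :=
  GRing.ComNzRing_isField.Build ultrapower ultra_mulV ultra_inv0.

Lemma ultra_class0 : ultra_class (fun=> 0) = 0. Proof. by []. Qed.

Lemma ultra_classD f g :
  ultra_class (fun x => f x + g x) = ultra_class f + ultra_class g.
Proof. by rewrite -ultra_addE. Qed.

Lemma ultra_classM f g :
  ultra_class (fun x => f x * g x) = ultra_class f * ultra_class g.
Proof. by rewrite -ultra_mulE. Qed.

Lemma ultra_class_sum (I : Type) (r : seq I) (P : pred I) (f : I -> T -> k) :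
  ultra_class (fun x => \sum_(i <- r | P i) f i x) =
  \sum_(i <- r | P i) ultra_class (f i).
Proof.
elim: r => [|i r IH].
  by rewrite big_nil -ultra_class0; congr ultra_class; apply/funext => x;
     rewrite big_nil.
rewrite big_cons -IH; case: ifP => Pi; rewrite -?ultra_classD;
  by congr ultra_class; apply/funext => x; rewrite big_cons Pi.
Qed.

Definition ultra_const (c : k) : ultrapower := ultra_class (fun=> c).

Lemma ultra_const_zmod : zmod_morphism ultra_const.
Proof.
move=> a b; rewrite -[- ultra_const b]/(ultra_opp _) ultra_oppE.
by rewrite -ultra_classD.
Qed.

Lemma ultra_const_monoid : monoid_morphism ultra_const.
Proof. by split=> // a b; rewrite -ultra_classM. Qed.

HB.instance Definition _ :=
  GRing.isZmodMorphism.Build k ultrapower ultra_const ultra_const_zmod.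
HB.instance Definition _ :=
  GRing.isMonoidMorphism.Build k ultrapower ultra_const ultra_const_monoid.

Lemma ultra_classX f n :
  ultra_class (fun x => f x ^+ n) = ultra_class f ^+ n.
Proof.
elim: n => [|n IH]; first by rewrite expr0.
by rewrite exprS -IH -ultra_classM; congr ultra_class; apply/funext => x;
   rewrite exprS.
Qed.

(** The monic equation is solved at each point of [T] separately; the chosen roots need not depend
    on the point in any regular way. *)
Lemma ultrapower_closed : GRing.closed_field_axiom ultrapower.
Proof.
move=> n P n_gt0.
have Q i : {f | P i = ultra_class f}.
  by exists (repr (P i)); rewrite /ultra_class reprK.
pose f i := sval (Q i); have fE i : P i = ultra_class (f i) := svalP (Q i).
have H x : {y | y ^+ n = \sum_(i < n) f i x * y ^+ i}.
  by apply/cid; exact: (@solve_monicpoly k n (f^~ x)).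
exists (ultra_class (fun x => sval (H x))).
rewrite -ultra_classX; under eq_bigr do rewrite fE -ultra_classX -ultra_classM.
rewrite -ultra_class_sum; congr ultra_class; apply/funext => x.
exact: (svalP (H x)).
Qed.

End Ultrapower.

HB.instance Definition _ (k : closedFieldType) (T : Type) (U : set_system T)
    (UU : UltraFilter U) :=
  Field_isAlgClosed.Build (ultrapower k UU) (@ultrapower_closed k T U UU).

(** * Valuation rings *)

Section Valuation.
Variables (k : closedFieldType) (L : fieldType) (iota : {rmorphism k -> L}).
Implicit Types (O : set L) (x y : L).

(** [p] splits over [k], and [x] differs from the image of every root. *)
Lemma transcendental_over_closed x (p : {poly k}) :
  (forall c, x <> iota c) -> p != 0 -> (map_poly iota p).[x] != 0.
Proof.
move=> xk p0; have [r ->] := closed_field_poly_normal p.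
rewrite map_polyZ hornerZ mulf_neq0 ?fmorph_eq0 ?lead_coef_eq0 //.
rewrite rmorph_prod horner_prod; elim: r => [|z r IH].
  by rewrite big_nil oner_neq0.
rewrite big_cons mulf_neq0 // rmorphB /= map_polyX map_polyC !hornerE subr_eq0.
by apply/eqP; exact: xk.
Qed.

Definition subalgebra O : Prop :=
  [/\ forall c, O (iota c), forall x y, O x -> O y -> O (x + y)
    & forall x y, O x -> O y -> O (x * y)].

Definition valuation_ring O : Prop :=
  subalgebra O /\ forall x, O x \/ O x^-1.

Lemma subalgebra0 O : subalgebra O -> O 0.
Proof. by case=> Oc _ _; rewrite -(rmorph0 iota). Qed.

Lemma subalgebra1 O : subalgebra O -> O 1.
Proof. by case=> Oc _ _; rewrite -(rmorph1 iota). Qed.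

Lemma subalgebraN O x : subalgebra O -> O x -> O (- x).
Proof.
case=> Oc _ OM Ox; rewrite -mulN1r -(rmorph1 iota) -rmorphN.
exact: OM.
Qed.

Lemma subalgebraX O x n : subalgebra O -> O x -> O (x ^+ n).
Proof.
move=> OS Ox; elim: n => [|n IH]; first by rewrite expr0; exact: subalgebra1.
by rewrite exprS; case: OS => _ _; exact.
Qed.

Lemma subalgebra_sum O (I : Type) (r : seq I) (P : pred I) (f : I -> L) :
  subalgebra O -> (forall i, O (f i)) -> O (\sum_(i <- r | P i) f i).
Proof.
move=> OS Of; apply: (big_ind O) => //; first exact: subalgebra0.
by case: OS.
Qed.

Definition adjoin O x : set L :=
  [set y | exists2 p : {poly L}, (forall i, O p`_i) & y = p.[x]].

Lemma adjoin_subalgebra O x : subalgebra O -> subalgebra (adjoin O x).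
Proof.
move=> OS; have [Oc OD OM] := OS; split.
- move=> c; exists (iota c)%:P => [i|]; last by rewrite hornerC.
  by rewrite coefC; case: ifP => _ //; exact: subalgebra0.
- move=> _ _ [p Op ->] [q Oq ->]; exists (p + q); last by rewrite hornerD.
  by move=> i; rewrite coefD; exact: OD.
- move=> _ _ [p Op ->] [q Oq ->]; exists (p * q); last by rewrite hornerM.
  by move=> i; rewrite coefM; apply: subalgebra_sum => // j; exact: OM.
Qed.

Lemma sub_adjoin O x : subalgebra O -> O `<=` adjoin O x.
Proof.
move=> OS y Oy; exists y%:P => [i|]; last by rewrite hornerC.
by rewrite coefC; case: ifP => _ //; exact: subalgebra0.
Qed.

Lemma mem_adjoin O x : subalgebra O -> adjoin O x x.
Proof.
move=> OS; exists 'X => [i|]; last by rewrite hornerX.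
by rewrite coefX; case: eqP => _; [exact: subalgebra1|exact: subalgebra0].
Qed.

Section Maximal.
Variables (O : set L) (a : L).
Hypotheses (OS : subalgebra O) (Oa : O a) (nOa : ~ O a^-1).
Hypothesis Omax :
  forall B, subalgebra B -> O `<=` B -> ~ B a^-1 -> B `<=` O.

Let a0 : a != 0.
Proof.
by apply/eqP => a0; apply: nOa; rewrite a0 invr0; exact: subalgebra0.
Qed.

(* [O[u^-1]] still omits [a^-1], because [u ^+ n] is [1] modulo [a O]. *)
Lemma maximal_subalgebra_inv q : O q -> O (1 - a * q)^-1.
Proof.
move=> Oq; set u := 1 - a * q.
have [Oc OD OM] := OS.
have Ou : O u by apply: OD; [exact: subalgebra1|apply: subalgebraN=> //; exact: OM].
have uX n : exists2 o, O o & u ^+ n = 1 - a * o.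
  elim: n => [|n [o Oo un]].
    by exists 0; [exact: subalgebra0 | rewrite mulr0 subr0].
  exists (q + u * o); last by rewrite exprS un /u; ring.
  by apply: OD => //; exact: OM.
have uXn0 n : u ^+ n != 0.
  have [o Oo ->] := uX n; rewrite subr_eq0; apply/eqP => ao.
  by apply: nOa; rewrite -[a^-1]mulr1 ao mulKf.
suff nB : ~ adjoin O u^-1 a^-1.
  have := Omax (adjoin_subalgebra u^-1 OS) (@sub_adjoin _ u^-1 OS) nB.
  by apply; exact: mem_adjoin.
case=> p Op pu; apply: nOa.
have H : exists2 o, O o & a^-1 * u ^+ size p = o.
  exists (a^-1 * u ^+ size p) => //; rewrite pu horner_coef mulr_suml.
  apply: subalgebra_sum => // i.
  rewrite -mulrA; apply: OM => //.
  have -> : u ^+ size p = u ^+ i * u ^+ (size p - i).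
    by rewrite -exprD subnKC // ltnW.
  rewrite exprVn mulKf //.
  exact: subalgebraX.
have [o Oo ao] := H; have [o' Oo' uo] := uX (size p).
have -> : a^-1 = o + o' by rewrite -ao uo; field.
exact: OD.
Qed.

(** This says that [a^-1] lies in [O[x]], with a bound on the degree: [1] is a polynomial in [x] of
    degree below [n] with coefficients in [a O]. *)
Let rel x n := exists2 p : nat -> L, (forall i, O (p i)) &
  \sum_(i < n) a * p i * x ^+ i = 1.

Let relW x m n : (m <= n)%N -> rel x m -> rel x n.
Proof.
move=> mn [p Op px]; exists (fun i => if (i < m)%N then p i else 0).
  by move=> i; case: ifP => // _; exact: subalgebra0.
rewrite -px (big_ord_widen n (fun i => a * p i * x ^+ i) mn) [RHS]big_mkcond /=.
by apply: eq_bigr => i _; case: ifP => // _; rewrite mulr0 mul0r.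
Qed.

(** Multiplied by [x ^+ n], the relation for [x^-1] expresses [(1 - a * q 0) * x ^+ n] through lower
    powers. The coefficient is a unit of [O], so the top term of the relation for [x] can be
    eliminated. *)
Let rel_decr x n : rel x n.+1 -> rel x^-1 n.+1 -> rel x n.
Proof.
have [x0|x0] := eqVneq x 0.
  move=> [p Op]; rewrite big_ord_recl expr0 mulr1 big1.
    rewrite addr0 /= => a1 _; case: nOa.
    by rewrite -[a^-1]mulr1 -a1 mulKf.
  by move=> i _; rewrite x0 /bump /= expr0n mulr0.
move=> [p Op px] [q Oq qx].
have [Oc OD OM] := OS.
have uO := maximal_subalgebra_inv (Oq 0%N).
have u0 : 1 - a * q 0%N != 0.
  rewrite subr_eq0; apply/eqP => a1; apply: nOa.
  by rewrite -[a^-1]mulr1 a1 mulKf.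
set u := 1 - a * q 0%N in uO u0.
exists (fun i => p i + a * p n * u^-1 * q (n - i)%N).
  by move=> i; apply: (OD) => //; do 3?apply: (OM).
have {}qx : u * x ^+ n = \sum_(i < n) a * q (n - i)%N * x ^+ i.
  have : u = \sum_(i < n) a * q i.+1 * x^-1 ^+ i.+1.
    by rewrite /u -qx big_ord_recl expr0 mulr1 addrC addKr.
  move=> ->; rewrite mulr_suml (reindex_inj rev_ord_inj) /=.
  apply: eq_bigr => i _; rewrite subnSK // -[LHS]mulrA; congr (_ * _).
  have -> : x ^+ n = x ^+ (n - i) * x ^+ i by rewrite -exprD subnK // ltnW.
  by rewrite exprVn mulKf // expf_neq0.
under eq_bigr => i _.
  have -> : a * (p i + a * p n / u * q (n - i)%N) * x ^+ i =
    a * p i * x ^+ i + a * p n / u * (a * q (n - i)%N * x ^+ i) by ring.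
  over.
rewrite big_split /= -mulr_sumr -qx mulrA divfK //.
by rewrite -[RHS]px big_ord_recr.
Qed.

(** If [x] and [x^-1] are both outside [O], maximality puts [a^-1] in both extensions, so each has a
    shortest relation. The longer one is then shortened by the other, padded with zeros by
    [relW]. *)
Lemma maximal_subalgebra_valuation : valuation_ring O.
Proof.
split=> // x; have [Ox|nx] := pselect (O x); first by left.
have [Oy|ny] := pselect (O x^-1); first by right.
have relP y : ~ O y -> exists n, rel y n.
  move=> nOy; have : adjoin O y a^-1.
    apply: contrapT => ny'; apply: nOy.
    exact: (Omax (adjoin_subalgebra y OS) (@sub_adjoin _ y OS) ny' (mem_adjoin y OS)).
  case=> p Op py; exists (size p); exists (fun i => p`_i) => //.
  under eq_bigr do rewrite -mulrA.
  by rewrite -mulr_sumr -horner_coef -py divff.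
have rel0 y : ~ rel y 0.
  by case=> p _; rewrite big_ord0 => /esym/eqP; rewrite oner_eq0.
have minP y : ~ O y -> exists2 n, rel y n.+1 & ~ rel y n.
  move=> nOy; have exP : exists n, `[< rel y n >].
    by have [n ?] := relP y nOy; exists n; apply/asboolP.
  case: (ex_minnP exP) => -[|n] /asboolP yn nmin; first by have := rel0 _ yn.
  exists n => // /asboolP /nmin; by rewrite ltnn.
have [n xn nxn] := minP x nx; have [m ym nym] := minP _ ny.
exfalso; have [mn|/ltnW nm] := leqP m n.
  by apply: nxn; apply: rel_decr => //; exact: relW ym.
by apply: nym; apply: rel_decr; rewrite ?invrK //; exact: relW xn.
Qed.

End Maximal.

(** Zorn's lemma among the subalgebras that contain [a] and omit [a^-1]. The algebra [k[a]] is one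
    of them, since [a^-1 = p(a)] would make [a] a root of [X p - 1]. *)
Lemma exists_valuation_ring a : (forall c, a <> iota c) ->
  exists O, [/\ valuation_ring O, O a & ~ O a^-1].
Proof.
move=> ak.
pose good O := [/\ subalgebra O, O a & ~ O a^-1].
pose R := adjoin (range iota) a.
have kS : subalgebra (range iota).
  split; first by move=> c; exists c.
    by move=> _ _ [c _ <-] [d _ <-]; exists (c + d); rewrite ?rmorphD.
  by move=> _ _ [c _ <-] [d _ <-]; exists (c * d); rewrite ?rmorphM.
have a0 : a != 0 by apply/eqP => a0; apply: (ak 0); rewrite rmorph0.
have Rgood : good R.
  split; [exact: adjoin_subalgebra|exact: mem_adjoin|].
  case=> p pk pa.
  have H i : {c | iota c = p`_i} by apply/cid; have [c _] := pk i; exists c.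
  pose q := \poly_(i < size p) sval (H i).
  have qp : map_poly iota q = p.
    apply/polyP => i; rewrite coef_map coef_poly; case: ltnP => ip.
      exact: (svalP (H i)).
    by rewrite nth_default //; exact: rmorph0.
  have q1 : 'X * q - 1 != 0.
    apply/eqP => /(congr1 (horner^~ 0)); rewrite !hornerE => /eqP.
    by rewrite eqr_oppLR oppr0 oner_eq0.
  have := transcendental_over_closed ak q1.
  rewrite rmorphB rmorphM /= map_polyX rmorph1 qp !hornerE -pa divff //.
  by rewrite subrr eqxx.
pose P O := O = set0 \/ good O.
have [|O [PO Omax]] := @Zorn_bigcup L P.
  move=> F Fsub Ftot.
  have [F0|nF0] := pselect (exists2 A, F A & A !=set0); last first.
    left; apply/seteqP; split=> // x [A FA Ax].
    by apply: nF0; exists A => //; exists x.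
  have gF A x : F A -> A x -> good A.
    by move=> FA Ax; have [A0|//] := Fsub _ FA; rewrite A0 in Ax.
  have [A0 FA0 [x0 A0x0]] := F0; right.
  have [[A0c _ _] A0a _] := gF _ _ FA0 A0x0.
  have two x y : (\bigcup_(X in F) X) x -> (\bigcup_(X in F) X) y ->
      exists A, [/\ F A, good A, A x & A y].
    move=> [A FA Ax] [B FB By].
    have [AB|BA] := Ftot _ _ FA FB.
      by exists B; split=> //; [exact: gF By|exact: AB].
    by exists A; split=> //; [exact: gF Ax|exact: BA].
  split; first split.
  - by move=> c; exists A0.
  - by move=> x y Fx Fy; have [A [FA [[_ AD _] _ _] Ax Ay]] := two _ _ Fx Fy;
       exists A => //; exact: AD.
  - by move=> x y Fx Fy; have [A [FA [[_ _ AM] _ _] Ax Ay]] := two _ _ Fx Fy;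
       exists A => //; exact: AM.
  - by exists A0.
  - by move=> [A FA Aa]; have [_ _] := gF _ _ FA Aa; exact.
have [O0|[OS Oa nOa]] := PO.
  exfalso; apply: (Omax R); last by right.
  have [_ Ra _] := Rgood; rewrite O0; split=> // /(_ _ Ra).
  by [].
exists O; split=> //; apply: (maximal_subalgebra_valuation OS Oa nOa).
move=> B BS OB nB; apply: contrapT => nBO.
by apply: (Omax B); [split|right; split=> //; exact: OB].
Qed.

End Valuation.

Section ValuationTheory.
Variables (k : closedFieldType) (L : fieldType) (iota : {rmorphism k -> L}).
Variable O : set L.
Hypothesis OV : valuation_ring iota O.

(** The maximal ideal of [O]. The guard [x != 0] keeps zero in it, since [0^-1 = 0] belongs to
    [O]. *)
Definition valuation_ideal : set L := [set x | O x /\ (x != 0 -> ~ O x^-1)].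

Let OS : subalgebra iota O. Proof. by case: OV. Qed.

Lemma valuation_ideal0 : valuation_ideal 0.
Proof. by split; [exact: subalgebra0 OS | rewrite eqxx]. Qed.

Lemma valuation_idealD x y :
  valuation_ideal x -> valuation_ideal y -> valuation_ideal (x + y).
Proof.
move=> mx my; have [_ OD OM] := OS.
split; first by apply: OD; [case: mx | case: my].
move=> xy0 Oxy.
have [x0|x0] := eqVneq x 0.
  by rewrite x0 add0r in xy0 Oxy; case: my => _ /(_ xy0).
have [y0|y0] := eqVneq y 0.
  by rewrite y0 addr0 in xy0 Oxy; case: mx => _ /(_ xy0).
have [Oxy'|Oxy'] := OV.2 (x / y).
  case: my => _ /(_ y0); apply.
  have -> : y^-1 = (x + y)^-1 * (x / y + 1) by field; rewrite y0.
  by apply: OM => //; apply: OD => //; exact: subalgebra1 OS.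
case: mx => _ /(_ x0); apply.
have -> : x^-1 = (x + y)^-1 * ((x / y)^-1 + 1).
  by rewrite invf_div; field; rewrite xy0 x0.
by apply: OM => //; apply: OD => //; exact: subalgebra1 OS.
Qed.

Lemma valuation_idealZ c x : valuation_ideal x -> valuation_ideal (iota c * x).
Proof.
case=> Ox mx; have [Oc _ OM] := OS; split; first exact: OM.
rewrite mulf_eq0 negb_or => /andP[c0 x0] Ocx; apply: (mx x0).
have -> : x^-1 = iota c * (iota c * x)^-1 by rewrite invfM mulVKf.
exact: OM.
Qed.

Lemma valuation_ideal_sum (I : Type) (r : seq I) (f : I -> L) :
  (forall i, valuation_ideal (f i)) -> valuation_ideal (\sum_(i <- r) f i).
Proof.
move=> mf; apply: (big_ind valuation_ideal) => //.
  exact: valuation_ideal0.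
exact: valuation_idealD.
Qed.

Lemma valuation_max (m : nat) (l : 'I_m -> L) (i0 : 'I_m) : l i0 != 0 ->
  exists2 j, l j != 0 & forall i, O (l i / l j).
Proof.
have [_ _ OM] := OS => l0.
suff H (s : seq 'I_m) : exists2 j, l j != 0 & forall i, i \in s -> O (l i / l j).
  have [j j0 jP] := H (index_enum _); exists j => // i; apply: jP.
  exact: mem_index_enum.
elim: s => [|a s [j j0 jP]]; first by exists i0.
have [Oa|Oa] := OV.2 (l a / l j).
  by exists j => // i; rewrite inE => /predU1P[->|/jP].
have [a0|a0] := eqVneq (l a) 0.
  exists j => // i; rewrite inE => /predU1P[->|/jP //].
  by rewrite a0 mul0r; exact: subalgebra0 OS.
exists a => // i; rewrite inE => /predU1P[->|/jP Oi].
  by rewrite divff //; exact: subalgebra1 OS.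
have -> : l i / l a = l i / l j * (l a / l j)^-1.
  by rewrite invf_div; field; rewrite a0 j0.
exact: OM.
Qed.

End ValuationTheory.

(** * Algebraic families and their valuations *)

Section Families.
Variables (k : closedFieldType) (L : fieldType) (iota : {rmorphism k -> L}).
Variables (G : Type) (V : set G) (A : set (G -> k)).
Hypothesis A_comb : forall (m : nat) (a : 'I_m -> G -> k) (c : 'I_m -> k),
  (forall i, A (a i)) -> A (fun g => \sum_i c i * a i g).
Hypothesis A_irr : forall a b, A a -> A b -> (forall v, V v -> a v * b v = 0) ->
  (forall v, V v -> a v = 0) \/ (forall v, V v -> b v = 0).

(* [A] stands for the regular functions on [G], and [V] for an irreducible subset:
   an algebraic family is an element of [A (x) L] restricted to [V]. *)
Definition family_of (m : nat) (a : G -> 'rV[k]_m) (l : 'I_m -> L)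
    (c : G -> L) : Prop :=
  (forall j, A (fun g => a g ord0 j)) /\
  forall v, V v -> c v = \sum_j iota (a v ord0 j) * l j.

Definition algebraic_family (c : G -> L) : Prop :=
  exists m (a : G -> 'rV[k]_m) (l : 'I_m -> L), family_of a l c.

Lemma regular_mulmx (m n : nat) (a : G -> 'rV[k]_m) (B : 'M[k]_(m, n)) :
  (forall j, A (fun g => a g ord0 j)) ->
  forall j, A (fun g => (a g *m B) ord0 j).
Proof.
move=> Aa j.
have -> : (fun g => (a g *m B) ord0 j) =
  (fun g => \sum_i B i j * a g ord0 i).
  by apply/funext => g; rewrite mxE; apply: eq_bigr => i _; rewrite mulrC.
exact: (A_comb (a := fun i g => a g ord0 i)).
Qed.

(* [e] has the least valuation among the values of the family, and this least
   value is attained on a nonempty open set, the complement of [b = 0]. *)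
Lemma family_valuation (O : set L) (c : G -> L) :
  valuation_ring iota O -> algebraic_family c -> (exists2 v, V v & c v != 0) ->
  exists e b, [/\ e != 0, forall v, V v -> O (c v / e), A b,
    exists2 v, V v & b v != 0 & forall v, V v -> b v != 0 -> O (e / c v)].
Proof.
move=> OV [m [a [l H]]] [v0 Vv0 cv0].
elim: m {-2}m (leqnn m) => [|M IH] m mM in a l H *.
  case: H => _ cE; move: cv0; rewrite cE // big1 ?eqxx //.
  by move=> i _; have := leq_trans (ltn_ord i) mM; rewrite ltn0.
have OS := OV.1; have [Oc OD OM] := OS.
have [Aa cE] := H.
have [j0 j00 j0max] : exists2 j, l j != 0 & forall i, O (l i / l j).
  have [l0|] := pselect (exists j, l j != 0).
    by have [j ?] := l0; exact: (valuation_max OV (i0 := j)).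
  move=> nl; exfalso; move/eqP: cv0; apply; rewrite cE // big1 // => j _.
  have [->|lj] := eqVneq (l j) 0; first by rewrite mulr0.
  by exfalso; apply: nl; exists j.
set e := l j0 in j00 j0max.
(* [K0] is a [k]-subspace: the coefficient vectors whose combination has valuation strictly greater
   than that of [e]. The basis vector of [j0] is not in it, since [1] is not in the maximal ideal,
   hence its dimension [r] is less than [m]. *)
pose K0 : set 'rV[k]_m :=
  [set w | valuation_ideal O (\sum_j iota (w ord0 j) * (l j / e))].
have [r [t [K0t ft Kt]]] := exists_row_basis K0 id.
set B := \matrix_i _ in ft Kt.
have rm : (r < m)%N.
  rewrite ltn_neqAle; apply/andP; split; last first.
    by rewrite -(eqP (ft : \rank _ == _)) rank_leq_col.
  apply/eqP => rm.
  have [D DE] : exists D, (delta_mx ord0 j0 : 'rV[k]_m) = D *m B.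
    apply/submxP.
    by rewrite submx_full // /row_full (eqP (ft : \rank _ == _)) rm.
  have : valuation_ideal O 1.
    have -> : 1 = \sum_i iota (D ord0 i) * \sum_j iota (t i ord0 j) * (l j / e).
      transitivity (\sum_j iota ((delta_mx ord0 j0 : 'rV_m) ord0 j) * (l j / e)).
        rewrite (bigD1 j0) //= big1 => [|j jj]; rewrite mxE eqxx /=.
          by rewrite eqxx rmorph1 mul1r divff // addr0.
        by rewrite (negPf jj) rmorph0 mul0r.
      rewrite DE; under eq_bigr do rewrite mxE rmorph_sum mulr_suml.
      rewrite exchange_big /=; apply: eq_bigr => i _.
      rewrite mulr_sumr; apply: eq_bigr => j _.
      by rewrite rmorphM /= /B mxE -[LHS]mulrA.
    apply: (valuation_ideal_sum OV) => i; apply: (valuation_idealZ OV).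
    exact: K0t.
  case=> _ /(_ (oner_neq0 _)); apply; rewrite invr1; exact: subalgebra1 OS.
(* A nonzero coordinate of [b v] certifies that [a v] is outside [K0], and then [c v / e] is a unit
   of [O]. If all coordinates vanish on [V], the values of [a] lie in [K0], so [c] has an expression
   with only [r] terms. *)
pose b v := a v *m cokermx B.
have [[j [v Vv bv]]|nb] := pselect (exists j, exists2 v, V v & b v ord0 j != 0).
  exists e, (fun v => b v ord0 j); split=> //.
  - move=> w Vw; rewrite cE // mulr_suml; apply: (subalgebra_sum _ _ OS) => i.
    by rewrite -mulrA; exact: OM.
  - exact: regular_mulmx.
  - by exists v.
  move=> w Vw bw.
  have nK : ~ K0 (a w).
    move=> /Kt /=; rewrite submxE => /eqP bw0.
    by move: bw; rewrite /b bw0 mxE eqxx.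
  have cwE : \sum_j iota (a w ord0 j) * (l j / e) = c w / e.
    by rewrite cE // mulr_suml; apply: eq_bigr => i _; rewrite mulrA.
  rewrite /K0 /= cwE in nK.
  apply: contrapT => nO; apply: nK; split.
    rewrite -cwE; apply: (subalgebra_sum _ _ OS) => i; exact: OM.
  by rewrite invf_div.
apply: (IH r _ (fun v => a v *m pinvmx B) (fun i => \sum_j iota (B i j) * l j)).
  exact: leq_trans rm mM.
split; first exact: regular_mulmx.
move=> v Vv.
have aB : (a v <= B)%MS.
  rewrite submxE; apply/eqP/rowP => j; rewrite [RHS]mxE.
  have [//|bv] := eqVneq ((a v *m cokermx B) ord0 j) 0.
  by exfalso; apply: nb; exists j, v.
rewrite cE //.
under eq_bigr => j _ do rewrite -{1}(mulmxKpV aB) mxE rmorph_sum mulr_suml.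
rewrite exchange_big /=; apply: eq_bigr => i _.
rewrite mulr_sumr; apply: eq_bigr => j _.
by rewrite rmorphM /= mulrA.
Qed.

Lemma family_constant (chi : G -> L) (v1 : G) :
  V v1 -> chi v1 = 1 -> (forall v, V v -> chi v != 0) ->
  algebraic_family chi -> algebraic_family (fun v => (chi v)^-1) ->
  forall v, V v -> exists c, chi v = iota c.
Proof.
move=> Vv1 chi1 chi0 fchi fchiV v Vv; apply: contrapT => nc.
have [|O [OV Oa nOa]] := @exists_valuation_ring _ _ iota (chi v).
  by move=> c ec; apply: nc; exists c.
have [_ OD OM] := OV.1.
have [|e [b [e0 ce Ab [w Vw bw] eb]]] := family_valuation OV fchi.
  by exists v1 => //; exact: chi0.
have [|e' [b' [e0' ce' Ab' [w' Vw' bw'] eb']]] := family_valuation OV fchiV.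
  by exists v1 => //; rewrite invr_neq0 // chi0.
(* Two nonempty open subsets of the irreducible [V] meet. *)
have [u Vu /andP[bu bu']] : exists2 u, V u & (b u != 0) && (b' u != 0).
  apply: contrapT => nu.
  have [|b0|b0] := A_irr Ab Ab'.
  - move=> u Vu; apply/eqP; rewrite mulf_eq0; apply: contraT.
    by rewrite negb_or => bb; exfalso; apply: nu; exists u.
  - by rewrite b0 // eqxx in bw.
  - by rewrite b0 // eqxx in bw'.
(* Both minima are attained at [u], so [e * e'] is in [O]. Comparing [chi^-1] at [v] with [e'], and
   [chi] at [v1], where it is [1], with [e] then puts [(chi v)^-1] in [O]. *)
have Oee : O (e * e').
  have := OM _ _ (eb u Vu bu) (eb' u Vu bu').
  rewrite (_ : e / chi u * _ = e * e') //.
  by rewrite invrK (mulrC e') mulrA divfK // chi0.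
apply: nOa.
have -> : (chi v)^-1 = (chi v)^-1 / e' * ((chi v1) / e) * (e * e').
  by rewrite chi1; field; rewrite e0 e0' (chi0 v Vv).
by apply: (OM) => //; apply: (OM); [exact: ce' | exact: ce].
Qed.

End Families.

(** * Families and finite-dimensional spans *)

Section CommonEigenvector.
Variable F : closedFieldType.

(** Induction on the dimension of a nonzero subspace stable under [S]. If some [A] is not scalar on
    it, the intersection with a suitable eigenspace of [A] is smaller, nonzero, and stable because
    the matrices commute. If all are scalar, any nonzero vector will do. *)
Lemma commuting_common_eigenvector (n : nat) (S : set 'M[F]_n) : (0 < n)%N ->
  (forall A B, S A -> S B -> A *m B = B *m A) ->
  exists2 w : 'rV[F]_n, w != 0 & forall A, S A -> exists c, w *m A = c *: w.
Proof.
move=> n0 Scomm.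
suff H r (U : 'M[F]_(r, n)) : row_free U -> (0 < r)%N ->
    (forall A, S A -> stablemx U A) ->
    exists2 w : 'rV[F]_n, w != 0 & forall A, S A -> exists c, w *m A = c *: w.
  apply: (H n 1%:M) => //; first by rewrite row_free_unit unitmx1.
  by move=> A _; exact: submx1.
elim: r {-2}r (leqnn r) U => [|M IH] r rM U Ufree r0 Ust.
  by move: r0; rewrite lt0n; move: rM; rewrite leqn0 => /eqP ->.
have [Sc|] := pselect (forall A, S A -> exists a, (U <= eigenspace A a)%MS).
  exists (row (Ordinal r0) U).
    apply/eqP => U0; have := row_free_inj Ufree (m := 1).
    move=> /(_ (delta_mx 0 (Ordinal r0)) 0); rewrite -rowE U0 mul0mx.
    move=> /(_ erefl) /matrixP /(_ 0 (Ordinal r0)) /eqP.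
    by rewrite !mxE !eqxx oner_eq0.
  move=> A /Sc [a Ua]; exists a; apply/eigenspaceP.
  exact: submx_trans (row_sub _ _) Ua.
move=> /existsNP [A /not_implyP [SA /forallNP nA]].
have [a] : exists a, eigenvalue (conjmx U A) a.
  have /closed_rootP [a rAa] : size (char_poly (conjmx U A)) != 1%N.
    by rewrite size_char_poly; case: (r) r0.
  by exists a; rewrite eigenvalue_root_char.
move=> /eigenvalueP [v /eigenspaceP]; rewrite sub_eigenspace_conjmx ?Ust //.
move=> vU v0.
pose W := (U :&: eigenspace A a)%MS.
have vW : (v *m U <= W)%MS by rewrite sub_capmx vU submxMl.
have Wr : (\rank W < r)%N.
  rewrite -[X in (_ < X)%N](eqP (Ufree : \rank _ == _)).
  have : (W < U)%MS.
    rewrite ltmxE capmxSl /=; apply/negP => UW; apply: (nA a).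
    exact: submx_trans UW (capmxSr _ _).
  by rewrite ltmxErank => /andP[].
apply: (IH _ _ (row_base W)).
- by rewrite -ltnS (leq_trans Wr).
- exact: row_base_free.
- rewrite lt0n mxrank_eq0; apply: contra v0 => /eqP W0.
  by rewrite W0 submx0 mulmx_free_eq0 in vW.
- move=> B SB; rewrite stablemx_row_base sub_capmx; apply/andP; split.
    exact: submx_trans (submxMr _ (capmxSl _ _)) (Ust _ SB).
  apply: submx_trans (submxMr _ (capmxSr _ _)) _.
  by apply: comm_mx_stable_eigenspace; exact: Scomm.
Qed.

(** The rows of [Q] are the standard basis without the vector of one index at which [w] is
    nonzero. *)
Lemma extend_to_unitmx (n : nat) (w : 'rV[F]_n.+1) : w != 0 ->
  exists Q : 'M[F]_(n, n.+1), (col_mx w Q : 'M_(1 + n)) \in unitmx.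
Proof.
move=> /rV0Pn [i0 wi0].
exists (\matrix_(i < n) delta_mx 0 (lift i0 i)).
set Q := \matrix_i _; set P := col_mx w Q.
have QP j : j != i0 -> ((delta_mx 0 j : 'rV[F]_n.+1) <= P)%MS.
  rewrite eq_sym => /unlift_some [i -> _].
  have QP : (Q <= P)%MS by rewrite -addsmxE addsmxSr.
  have <- : row i Q = delta_mx 0 (lift i0 i) by rewrite rowK.
  exact: submx_trans (row_sub _ _) QP.
rewrite -row_full_unit -sub1mx; apply/row_subP => i; rewrite row1.
have [->|/QP //] := eqVneq i i0.
have -> : delta_mx 0 i0 =
  (w ord0 i0)^-1 *: (w - \sum_(j | j != i0) w ord0 j *: delta_mx 0 j) :> 'rV_n.+1.
  rewrite {2}(row_sum_delta w) (bigD1 i0) //= addrK scalerA mulVf ?scale1r //.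
apply: scalemx_sub; apply: addmx_sub.
  by rewrite -addsmxE addsmxSl.
rewrite -scaleN1r; apply: scalemx_sub; apply: summx_sub => j jj.
exact/scalemx_sub/QP.
Qed.

End CommonEigenvector.

Section Span.
Variables (k L : fieldType) (iota : {rmorphism k -> L}).
Implicit Types (s t : seq L) (D : set L).

Inductive kspan (s : seq L) : L -> Prop :=
| kspan0 : kspan s 0
| kspanD x y : kspan s x -> kspan s y -> kspan s (x + y)
| kspanZ c x : kspan s x -> kspan s (iota c * x)
| kspan_mem x : x \in s -> kspan s x.

Definition kfinite D := exists s, forall x, D x -> kspan s x.

Lemma kspan_sum s (I : Type) (r : seq I) (P : pred I) (f : I -> L) :
  (forall i, kspan s (f i)) -> kspan s (\sum_(i <- r | P i) f i).
Proof.
by move=> sf; apply: (big_ind (kspan s)) => //; [exact: kspan0|exact: kspanD].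
Qed.

Lemma kspan_sub s t x : {subset s <= t} -> kspan s x -> kspan t x.
Proof.
move=> st; elim=> {x} [|x y _ sx _ sy|c x _ sx|x /st tx].
- exact: kspan0.
- exact: kspanD.
- exact: kspanZ.
- exact: kspan_mem.
Qed.

Lemma kspanM s t x y : kspan s x -> kspan t y ->
  kspan [seq a * b | a <- s, b <- t] (x * y).
Proof.
move=> sx; elim=> {y} [|y z _ IHy _ IHz|c y _ IHy|y ty].
- by rewrite mulr0; exact: kspan0.
- by rewrite mulrDr; exact: kspanD.
- by rewrite mulrCA; exact: kspanZ.
elim: sx => {x} [|x z _ IHy _ IHz|c x _ IHy|x sx].
- by rewrite mul0r; exact: kspan0.
- by rewrite mulrDl; exact: kspanD.
- by rewrite -mulrA; exact: kspanZ.
- by apply: kspan_mem; apply/allpairsP; exists (x, y).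
Qed.

Lemma kspan_coef s x : kspan s x ->
  exists a : 'rV[k]_(size s), x = \sum_j iota (a ord0 j) * s`_j.
Proof.
elim=> {x} [|x y _ [a ->] _ [b ->]|c x _ [a ->]|x sx].
- by exists 0; rewrite big1 // => i _; rewrite mxE rmorph0 mul0r.
- exists (a + b); rewrite -big_split; apply: eq_bigr => i _ /=.
  by rewrite mxE rmorphD mulrDl.
- exists (c *: a); rewrite mulr_sumr; apply: eq_bigr => i _.
  by rewrite mxE rmorphM /= mulrA.
have xs := sx; rewrite -index_mem in xs.
exists (delta_mx ord0 (Ordinal xs)).
rewrite (bigD1 (Ordinal xs)) //= big1 => [|j jx].
  by rewrite mxE !eqxx rmorph1 mul1r addr0 nth_index.
by rewrite mxE eqxx (negPf jx) rmorph0 mul0r.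
Qed.

Lemma kfinite_bigU (I : finType) (D : I -> set L) :
  (forall i, kfinite (D i)) -> kfinite [set x | exists i, D i x].
Proof.
move=> /choice [s sD]; exists (flatten [seq s i | i <- enum I]) => x [i Dx].
apply: kspan_sub (sD i x Dx) => y sy.
by apply/flattenP; exists (s i) => //; apply/mapP; exists i; rewrite ?mem_enum.
Qed.

Lemma kfiniteM D D' : kfinite D -> kfinite D' ->
  kfinite [set z | exists x y, [/\ D x, D' y & z = x * y]].
Proof.
move=> [s sD] [t tD']; exists [seq a * b | a <- s, b <- t].
by move=> _ [x [y [/sD ? /tD' ? ->]]]; exact: kspanM.
Qed.

Lemma kfiniteU D D' : kfinite D -> kfinite D' -> kfinite (D `|` D').
Proof.
move=> [s sD] [t tD']; exists (s ++ t) => x [/sD|/tD']; apply: kspan_sub => y;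
  by rewrite mem_cat => ->; rewrite ?orbT.
Qed.

End Span.

Section FamilyClosure.
Variables (k : closedFieldType) (L : fieldType) (iota : {rmorphism k -> L}).
Variables (G : Type) (V : set G) (A : set (G -> k)).
Local Notation family := (algebraic_family iota V A).

Lemma eq_family c c' : (forall v, V v -> c v = c' v) -> family c -> family c'.
Proof.
by move=> cc' [m [a [l [Aa cE]]]]; exists m, a, l; split=> // v Vv; rewrite -cc' ?cE.
Qed.

Lemma familyZ x c : family c -> family (fun v => x * c v).
Proof.
move=> [m [a [l [Aa cE]]]]; exists m, a, (fun j => x * l j); split=> // v Vv.
by rewrite cE // mulr_sumr; apply: eq_bigr => j _; rewrite mulrCA.
Qed.

Lemma family0 : family (fun=> 0).
Proof.
exists 0, (fun=> 0), (fun=> 0); split=> [[]//|v _]; by rewrite big_ord0.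
Qed.

Lemma familyD c d : family c -> family d -> family (fun v => c v + d v).
Proof.
move=> [m [a [l [Aa cE]]]] [n [b [l' [Ab dE]]]].
exists (m + n)%N, (fun g => row_mx (a g) (b g)).
exists (fun j => match split j with inl i => l i | inr i => l' i end); split.
  move=> j; case: (splitP j) => i ji.
    rewrite (_ : j = lshift n i); last exact: val_inj.
    by under eq_fun do rewrite row_mxEl; exact: Aa.
  rewrite (_ : j = rshift m i); last exact: val_inj.
  by under eq_fun do rewrite row_mxEr; exact: Ab.
move=> v Vv; rewrite cE // dE // big_split_ord; congr (_ + _); apply: eq_bigr => i _.
  by rewrite row_mxEl (unsplitK (inl i)).
by rewrite row_mxEr (unsplitK (inr i)).
Qed.

Lemma family_sum (I : Type) (r : seq I) (c : I -> G -> L) :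
  (forall i, family (c i)) -> family (fun v => \sum_(i <- r) c i v).
Proof.
move=> fc; elim: r => [|i r IH].
  by apply: eq_family family0 => v _; rewrite big_nil.
by apply: eq_family (familyD (fc i) IH) => v _; rewrite big_cons.
Qed.

Lemma family_mono f x : A f -> family (fun v => iota (f v) * x).
Proof.
move=> Af; exists 1, (fun g => const_mx (f g)), (fun=> x); split=> [j|v _].
  by under eq_fun do rewrite mxE.
by rewrite big_ord_recl big_ord0 addr0 mxE.
Qed.

Lemma family_mulmx (m n p q : nat) (P : 'M[L]_(m, n)) (Q : 'M[L]_(p, q))
    (rho : G -> 'M[L]_(n, p)) :
  (forall i j, family (fun v => rho v i j)) ->
  forall i j, family (fun v => (P *m rho v *m Q) i j).
Proof.
move=> frho i j.
apply: (@eq_family (fun v => \sum_b Q b j * \sum_a P i a * rho v a b)).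
  move=> v _; rewrite mxE; apply: eq_bigr => b _.
  by rewrite mxE mulrC.
by apply: family_sum => b; apply: familyZ; apply: family_sum => a; apply: familyZ.
Qed.

Lemma family_kfinite c :
  family c -> kfinite iota [set x | exists2 v, V v & x = c v].
Proof.
move=> [m [a [l [Aa cE]]]]; exists [seq l j | j <- enum 'I_m] => x [v Vv ->].
rewrite cE //; apply: kspan_sum => j; apply: kspanZ; apply: kspan_mem.
by apply/mapP; exists j; rewrite ?mem_enum.
Qed.

End FamilyClosure.

(** * Representations of a commutative group generated by a family *)

Section Words.
Variables (G : groupType) (V : set G).
Local Open Scope group_scope.
Local Notation Gamma := (subgroup_generated V).

Lemma subgroup_generated_subgroup : subgroup Gamma.
Proof.
split=> [H [[H1 _ _] _]//|f g Gf Gg H HV|f Gf H HV].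
- by have [[_ HM _] _] := HV; apply: HM; [exact: Gf|exact: Gg].
- by have [[_ _ HI] _] := HV; apply: HI; exact: Gf.
Qed.

Lemma sub_subgroup_generated : V `<=` Gamma.
Proof. by move=> g Vg H [_]; exact. Qed.

Lemma subgroup_generated_commutative :
  commutative_subset V -> commutative_subset Gamma.
Proof.
move=> Vc.
have cent (S : set G) : subgroup [set g | forall h, S h -> g * h = h * g].
  split=> [h _|f g fS gS h Sh|f fS h Sh]; first by rewrite mulg1 mul1g.
    by rewrite -mulgA gS // !mulgA fS.
  by apply: (mulgI f); rewrite mulgA mulgV mul1g mulgA fS // mulgK.
have GV g h : Gamma g -> V h -> g * h = h * g.
  move=> Gg; move: h; apply: (Gg [set g | forall h, V h -> g * h = h * g]).
  by split; [exact: cent | move=> f Vf h Vh; exact: Vc].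
move=> f g Gf; move: g; apply: (Gf [set g | forall h, Gamma h -> g * h = h * g]).
by split; [exact: cent | move=> h Vh g Gg; exact/esym/GV].
Qed.

(** Letters [v * w^-1] make the words of length [n] stable under inversion, and the trivial letter
    [1 * 1^-1] allows padding. *)
Fixpoint word (n : nat) : set G :=
  if n is n'.+1 then
    [set g | exists v w h, [/\ V v, V w, word n' h & g = v * w^-1 * h]]
  else [set 1].

Lemma word_cat m n g h : word m g -> word n h -> word (m + n) (g * h).
Proof.
elim: m g => [|m IH] g /=; first by move=> ->; rewrite mul1g.
move=> [v [w [g' [Vv Vw wg ->]]]] wh; exists v, w, (g' * h).
by split=> //; [exact: IH | rewrite mulgA].
Qed.

Lemma word1 v w : V v -> V w -> word 1 (v * w^-1).
Proof. by move=> Vv Vw; exists v, w, 1; rewrite mulg1. Qed.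

Lemma wordV n g : word n g -> word n g^-1.
Proof.
elim: n g => [|n IH] g /=; first by move=> ->; rewrite invg1.
move=> [v [w [h [Vv Vw wh ->]]]].
rewrite invgM invgM invgK.
by have := word_cat (IH _ wh) (word1 Vw Vv); rewrite addn1.
Qed.

Lemma word_le m n : V 1 -> (m <= n)%N -> word m `<=` word n.
Proof.
move=> V1 /subnK <- g wg; elim: (n - m)%N => [//|d IH].
by rewrite addSn; exists 1, 1, g; rewrite invg1 !mul1g.
Qed.

Lemma subgroup_generated_word : V 1 -> Gamma = [set g | exists n, word n g].
Proof.
move=> V1; apply/seteqP; split.
  move=> g; apply; split; last first.
    by move=> v Vv; exists 1%N; exists v, 1, 1; rewrite invg1 !mulg1.
  split; first by exists 0%N.
  - by move=> f h [m wf] [n wh]; exists (m + n)%N; exact: word_cat.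
  - by move=> f [m wf]; exists m; exact: wordV.
have [G1 GM GI] := subgroup_generated_subgroup.
move=> g [n]; elim: n g => [|n IH] g; first by move=> /= ->.
move=> [v [w [h [Vv Vw wh ->]]]]; apply: (GM); last exact: IH.
by apply: (GM); [|apply: GI]; exact: sub_subgroup_generated.
Qed.

End Words.

Section Representation.
Variables (k L : closedFieldType) (iota : {rmorphism k -> L}).
Variables (G : groupType) (V : set G) (A : set (G -> k)).
Hypothesis A_comb : forall (m : nat) (a : 'I_m -> G -> k) (c : 'I_m -> k),
  (forall i, A (a i)) -> A (fun g => \sum_i c i * a i g).
Hypothesis A_irr : forall a b, A a -> A b -> (forall v, V v -> a v * b v = 0) ->
  (forall v, V v -> a v = 0) \/ (forall v, V v -> b v = 0).
Hypotheses (V1 : V 1%g) (Vcomm : commutative_subset V).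
Local Notation Gamma := (subgroup_generated V).
Local Notation family := (algebraic_family iota V A).

(* Splitting off a common eigenvector [w] makes [rho] block triangular, with a
   character [chi], a smaller representation [rho'] and a corner [u]; along a word
   [u] only picks up constants [chi] and a single factor [rho' * u(letter)]. *)
Lemma representation_kfinite (n : nat) (rho : G -> 'M[L]_n) :
  rho 1%g = 1%:M ->
  (forall a b, Gamma a -> Gamma b -> rho (a * b)%g = rho a *m rho b) ->
  (forall i j, family (fun v => rho v i j)) ->
  (forall i j, family (fun v => rho (v^-1)%g i j)) ->
  kfinite iota [set x | exists g i j, Gamma g /\ x = rho g i j].
Proof.
have [G1 GM GI] := subgroup_generated_subgroup V.
have GV := @sub_subgroup_generated _ V.
have Gcomm := subgroup_generated_commutative Vcomm.
elim: n rho => [|n IH] rho rho1 rhoM frho frhoV.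
  by exists [::] => x [g [i _]]; case: i.
have [|w w0 wP] := @commuting_common_eigenvector L n.+1 [set rho g | g in Gamma] isT.
  by move=> _ _ [g Gg <-] [h Gh <-]; rewrite -!rhoM // Gcomm.
have [Q] := extend_to_unitmx w0; set P := col_mx w Q => Pu.
pose E : 'M[L]_(n.+1, 1) := lsubmx (invmx P).
pose K : 'M[L]_(n.+1, n) := rsubmx (invmx P).
have PE : P *m row_mx E K = 1%:M by rewrite hsubmxK mulmxV.
have EP : E *m w + K *m Q = 1%:M.
  by rewrite -mul_row_col hsubmxK -/P mulVmx.
have [wE wK QE QK] : [/\ w *m E = 1%:M, w *m K = 0, Q *m E = 0 & Q *m K = 1%:M].
  have := PE; rewrite mul_col_row scalar_mx_block => /eq_block_mx.
  by case=> -> -> -> ->.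
pose chi g := (w *m rho g *m E) ord0 ord0.
pose u g := Q *m rho g *m E.
pose rho' g := Q *m rho g *m K.
have wrho g : Gamma g -> w *m rho g = chi g *: w.
  move=> Gg; have [|c wc] := wP (rho g); first by exists g.
  by rewrite /chi wc -scalemxAl wE !mxE mulr1.
have rhoE g : Gamma g ->
    rho g = chi g *: (E *m w) + K *m u g *m w + K *m rho' g *m Q.
  move=> Gg; rewrite -[LHS]mul1mx -EP mulmxDl -(mulmxA E) wrho // -scalemxAr.
  rewrite -addrA; congr (_ + _).
  by rewrite -[LHS]mulmx1 -EP mulmxDr !mulmxA.
have chiM a b : Gamma a -> Gamma b -> chi (a * b)%g = chi a * chi b.
  move=> Ga Gb; rewrite /chi rhoM // mulmxA wrho // -scalemxAl wrho //.
  by rewrite -!scalemxAl wE !mxE !mulr1.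
have chi1 : chi 1%g = 1 by rewrite /chi rho1 mulmx1 wE mxE.
have chiV a : Gamma a -> chi a * chi (a^-1)%g = 1.
  by move=> Ga; rewrite -chiM ?mulgV //; exact: GI.
have chi0 a : Gamma a -> chi a != 0.
  move=> /chiV ca; apply/eqP => a0; move/eqP: ca.
  by rewrite a0 mul0r eq_sym oner_eq0.
have rho'M a b : Gamma a -> Gamma b -> rho' (a * b)%g = rho' a *m rho' b.
  move=> Ga Gb; rewrite /rho' rhoM // !mulmxA.
  rewrite -[Q *m rho a in LHS]mulmx1 -EP mulmxDr !mulmxDl !mulmxA.
  rewrite -(mulmxA (Q *m rho a *m E)) wrho // -scalemxAr -scalemxAl.
  by rewrite -(mulmxA _ w) wK mulmx0 scaler0 add0r.
have uM a b : Gamma a -> Gamma b ->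
    u (a * b)%g = chi b *: u a + rho' a *m u b.
  move=> Ga Gb; rewrite /u /rho' rhoM // !mulmxA.
  rewrite -[Q *m rho a in LHS]mulmx1 -EP mulmxDr !mulmxDl !mulmxA.
  rewrite -(mulmxA (Q *m rho a *m E)) wrho // -scalemxAr -scalemxAl.
  by rewrite -(mulmxA _ w) wE mulmx1.
have chi_const g : Gamma g -> exists c, chi g = iota c.
  have cV v : V v -> exists c, chi v = iota c.
    apply: (family_constant A_comb A_irr V1 chi1).
    - by move=> z /GV; exact: chi0.
    - exact: (family_mulmx w E frho).
    - apply: eq_family (family_mulmx w E frhoV ord0 ord0) => z Vz.
      apply: (mulfI (chi0 _ (GV _ Vz))).
      by rewrite divff ?chiV ?chi0 //; exact: GV.
  move=> Gg; have [|_ //] := Gg [set g | Gamma g /\ exists c, chi g = iota c].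
  split; last by move=> v Vv; split; [exact: GV|exact: cV].
  split; first by split=> //; exists 1; rewrite rmorph1.
  - move=> a b [Ga [c ac]] [Gb [d bd]]; split; first exact: GM.
    by exists (c * d); rewrite chiM // ac bd rmorphM.
  - move=> a [Ga [c ac]]; split; first exact: GI.
    exists c^-1; apply: (mulfI (chi0 _ Ga)).
    by rewrite chiV // fmorphV -ac divff // chi0.
have [s' s'P] : kfinite iota [set x | exists g i j, Gamma g /\ x = rho' g i j].
  apply: IH => //; first by rewrite /rho' rho1 mulmx1 QK.
  - exact: family_mulmx.
  - exact: family_mulmx.
have [su suP] : kfinite iota [set x | exists i,
    [set x | exists2 v, V v & x = u v i ord0] x].
  by apply: kfinite_bigU => i; exact: (family_kfinite (family_mulmx Q E frho _ _)).
have [sv svP] : kfinite iota [set x | exists i,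
    [set x | exists2 v, V v & x = u (v^-1)%g i ord0] x].
  by apply: kfinite_bigU => i; exact: (family_kfinite (family_mulmx Q E frhoV _ _)).
pose sp (s t : seq L) := [seq a * b | a <- s, b <- t].
pose s1 := su ++ sp s' sv.
have s1P v v' i : V v -> V v' -> kspan iota s1 (u (v * v'^-1)%g i ord0).
  move=> Vv Vv'; rewrite uM; [|exact: GV|exact: GI (GV _ Vv')].
  have [c ->] := chi_const _ (GI _ (GV _ Vv')).
  rewrite mxE; apply: kspanD.
    rewrite mxE; apply: kspanZ.
    apply: (@kspan_sub _ _ _ su) => [x xs|]; first by rewrite mem_cat xs.
    by apply: suP; exists i, v.
  rewrite mxE; apply: kspan_sum => j.
  apply: (@kspan_sub _ _ _ (sp s' sv)) => [x xs|]; first by rewrite mem_cat xs orbT.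
  apply: kspanM; first by apply: s'P; exists v, i, j; split=> //; exact: GV.
  by apply: svP; exists j, v'.
have uP g i : Gamma g -> kspan iota (s1 ++ sp s' s1) (u g i ord0).
  rewrite subgroup_generated_word // => -[m]; elim: m g i => [|m IHm] g i.
    by move=> /= ->; rewrite /u rho1 mulmx1 QE mxE; exact: kspan0.
  move=> [v [v' [h [Vv Vv' wh ->]]]].
  have Gh : Gamma h by rewrite subgroup_generated_word //; exists m.
  have Gvv : Gamma (v * v'^-1)%g by apply: GM; [|apply: GI]; exact: GV.
  (* Commutativity puts the letter last: [u h] is then multiplied by a constant, and the new term is
     [rho' h] times the corner of a letter, in a span that does not grow with [m]. *)
  rewrite Gcomm // uM // mxE; apply: kspanD.
    by rewrite mxE; have [c ->] := chi_const _ Gvv; apply: kspanZ; exact: IHm.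
  rewrite mxE; apply: kspan_sum => j.
  apply: (@kspan_sub _ _ _ (sp s' s1)) => [x xs|]; first by rewrite mem_cat xs orbT.
  by apply: kspanM; [apply: s'P; exists h, i, j|exact: s1P].
(* By [rhoE] the entries of [rho g] are combinations of products of a member of [D1], already
   controlled, and one of the finitely many members of [D2], which come from the change of basis. *)
pose D1 : set L := [set x | x = 1] `|`
  ([set x | exists g i j, Gamma g /\ x = rho' g i j] `|`
   [set x | exists g i, Gamma g /\ x = u g i ord0]).
have D1fin : kfinite iota D1.
  apply: kfiniteU; first by exists [:: 1] => x /= ->; apply: kspan_mem; rewrite mem_head.
  apply: kfiniteU; first by exists s'.
  by exists (s1 ++ sp s' s1) => x [g [i [Gg ->]]]; exact: uP.
pose D2 : set L :=
  [set x | exists p : 'I_n.+1 * 'I_n.+1, [set (E *m w) p.1 p.2] x] `|`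
  [set x | exists p : ('I_n.+1 * 'I_n) * 'I_n.+1,
    [set y | y = K p.1.1 p.1.2 * w ord0 p.2] x] `|`
  [set x | exists p : ('I_n.+1 * 'I_n) * ('I_n * 'I_n.+1),
    [set y | y = K p.1.1 p.1.2 * Q p.2.1 p.2.2] x].
have one (x : L) : kfinite iota [set y | y = x].
  by exists [:: x] => y /= ->; apply: kspan_mem; rewrite mem_head.
have D2fin : kfinite iota D2.
  by apply: kfiniteU; [apply: kfiniteU|]; apply: kfinite_bigU => p; exact: one.
have [s sP] := kfiniteM D1fin D2fin.
exists s => _ [g [i [j [Gg ->]]]].
rewrite (rhoE g Gg) mxE; apply: kspanD; first (rewrite mxE; apply: kspanD).
- rewrite mxE; have [c ->] := chi_const _ Gg; apply: kspanZ; apply: sP.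
  exists 1, ((E *m w) i j); split; rewrite ?mul1r //; first by left.
  by left; left; exists (i, j).
- rewrite mxE; apply: kspan_sum => a; rewrite mxE mulr_suml.
  apply: kspan_sum => b; apply: sP.
  exists (u g b ord0), (K i b * w ord0 j); split.
  + by right; right; exists g, b.
  + by left; right; exists ((i, b), j).
  + by rewrite (ord1 a); ring.
- rewrite mxE; apply: kspan_sum => a; rewrite mxE mulr_suml.
  apply: kspan_sum => b; apply: sP.
  exists (rho' g b a), (K i b * Q a j); split.
  + by right; left; exists g, b, a.
  + by right; exists ((i, b), (a, j)).
  + by ring.
Qed.

End Representation.

(** * Noetherianity and dimension of affine space *)

Section Dickson.
Local Open Scope nat_scope.

(** Pass repeatedly to an index at which the minimum of the remaining tail is attained. *)
Lemma ndecr_subsequence (g : nat -> nat) :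
  exists2 s : nat -> nat, (forall i, s i < s i.+1) &
    forall i j, i <= j -> g (s i) <= g (s j).
Proof.
have H m : exists2 j, m <= j & forall i, m <= i -> g j <= g i.
  have exP : exists v, `[< exists2 j, m <= j & g j = v >].
    by exists (g m); apply/asboolP; exists m.
  case: (ex_minnP exP) => v /asboolP [j mj <-] vmin; exists j => // i mi.
  by apply: vmin; apply/asboolP; exists i.
have /choice [f fP] : forall m, exists j, m <= j /\ forall i, m <= i -> g j <= g i.
  by move=> m; have [j] := H m; exists j.
pose s i := iter i (fun j => f j.+1) (f 0).
have s_lt i : s i < s i.+1 by have [] := fP (s i).+1.
exists s => // i j ij.
have sle : {homo s : a b / a <= b}.
  apply: (homo_leq (r := fun x y => x <= y)) => [x|x y z|x].
  - exact: leqnn.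
  - exact: leq_trans.
  - exact: ltnW.
case: i ij => [|i] ij; first by have [_] := fP 0; apply.
have [_] := fP (s i).+1; apply.
exact: leq_trans (s_lt i) (sle i.+1 j ij).
Qed.

(** Extracting once per coordinate yields a subsequence that is nondecreasing in every
    coordinate. *)
Lemma dickson (n : nat) (f : nat -> 'X_{1..n}) :
  exists i j, i < j /\ (f i <= f j)%MM.
Proof.
have incr (s : nat -> nat) : (forall i, s i < s i.+1) ->
    forall i j, i < j -> s i < s j.
  by move=> sP; apply: (homo_ltn (r := fun x y => x < y)) => // x y z; exact: ltn_trans.
suff [s sP sle] : exists2 s : nat -> nat, (forall i, s i < s i.+1) &
    forall c : 'I_n, forall i j, i <= j -> f (s i) c <= f (s j) c.
  exists (s 0), (s 1); split=> //.
  by apply/mnm_lepP => c; exact: sle.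
suff H m : m <= n -> exists2 s : nat -> nat, (forall i, s i < s i.+1) &
    forall c : 'I_n, c < m -> forall i j, i <= j -> f (s i) c <= f (s j) c.
  by have [s sP sle] := H n (leqnn n); exists s => // c; exact: sle.
elim: m => [|m IH] mn; first by exists id.
have [s sP sle] := IH (ltnW mn).
have [t tP tle] := ndecr_subsequence (fun i => f (s i) (Ordinal mn)).
have tmono i j : i <= j -> t i <= t j.
  by rewrite leq_eqVlt => /predU1P[->//|/(incr _ tP)/ltnW].
exists (s \o t) => [i|c]; first exact: (incr s sP _ _ (tP i)).
rewrite ltnS leq_eqVlt => /predU1P[cm|cm] i j ij /=.
  have -> : c = Ordinal mn by apply: val_inj.
  exact: tle.
by apply: sle => //; exact: tmono.
Qed.

End Dickson.

Section Noetherian.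
Variables (k : fieldType) (n : nat).
Implicit Types (p q : {mpoly k[n]}) (Y Z : set 'rV[k]_n).

Definition vanish Y p : Prop := forall x, Y x -> p.@[x ord0] = 0.

Lemma vanish_sub Y Z p : Z `<=` Y -> vanish Y p -> vanish Z p.
Proof. by move=> ZY pY x /ZY /pY. Qed.

(* Choose elements of [I i.+1] outside [I i] with least leading monomials; by
   Dickson's lemma one of these monomials divides a later one. *)
Lemma ideal_chain_stabilizes (I : nat -> set {mpoly k[n]}) :
  (forall i, I i 0) ->
  (forall i p q r, I i p -> I i q -> I i (p - r * q)) ->
  (forall i, I i `<=` I i.+1) ->
  exists i, I i.+1 `<=` I i.
Proof.
move=> I0 IB Imono; apply: contrapT => /forallNP nI.
have Ile i j : (i <= j)%N -> I i `<=` I j.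
  move=> /subnK <-; elim: (j - i)%N => [//|d IH] p /IH; exact: Imono.
have H i : exists p, [/\ I i.+1 p, ~ I i p &
    forall q, I i.+1 q -> ~ I i q -> ~ (mlead q < mlead p)%O].
  have [p0 [Ip0 nIp0]] : exists p, I i.+1 p /\ ~ I i p.
    by apply: contrapT => /forallNP nn; apply: (nI i) => p Ip;
       apply: contrapT => nIp; exact: (nn p).
  move: {2}(mlead p0) (erefl (mlead p0)) => m.
  elim/(well_founded_induction (@ltom_wf n)): m p0 Ip0 nIp0 => m IH p Ip nIp pm.
  have [[q [Iq nIq qp]]|nq] := pselect (exists q, [/\ I i.+1 q, ~ I i q &
      (mlead q < mlead p)%O]).
    by apply: (IH (mlead q) _ q); rewrite // -pm.
  by exists p; split=> // q Iq nIq qp; apply: nq; exists q.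
have /choice [p pP] := H.
have [i [j [ij le_ij]]] := dickson (fun i => mlead (p i)).
have [Ipi nIpi _] := pP i; have [Ipj nIpj pjmin] := pP j.
have pi0 : p i != 0 by apply/eqP => p0; apply: nIpi; rewrite p0.
have pj0 : p j != 0 by apply/eqP => p0; apply: nIpj; rewrite p0.
pose c := mleadc (p j) / mleadc (p i).
pose r := c *: 'X_[mlead (p j) - mlead (p i)] : {mpoly k[n]}.
have Ipij : I j (p i) by exact: (Ile i.+1).
have c0 : c != 0 by rewrite mulf_neq0 ?invr_eq0 ?mleadc_eq0.
have r0 : r != 0.
  by rewrite -msize_poly_eq0 msizeZ // msizeX //.
have rlead : mlead (r * p i) = mlead (p j).
  rewrite mleadM // mleadZ // mleadXm; exact: submK.
have rcoef : (r * p i)@_(mlead (p j)) = mleadc (p j).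
  rewrite -{1}rlead mleadM // mleadcM mleadZ // mcoeffZ mleadXm mcoeffX eqxx mulr1.
  by rewrite /c divfK // mleadc_eq0.
(* The subtraction cancels the leading term of [p j]. Since [p i] already lies in [I j], [q] is
   still in [I j.+1] and outside [I j], against the minimality of the leading monomial of [p j]. *)
pose q := p j - r * p i.
have nIq : ~ I j q.
  move=> Iq; apply: nIpj.
  have -> : p j = q - (- r) * p i by rewrite /q mulNr opprK subrK.
  exact: IB.
have Iq : I j.+1 q by apply: IB => //; exact: Imono.
have q0 : q != 0 by apply/eqP => q0; apply: nIq; rewrite q0.
apply: (pjmin q) => //; rewrite lt_neqAle; apply/andP; split.
  apply/eqP => qE; move: q0; rewrite -mleadc_eq0 qE /q mcoeffB rcoef subrr.
  by rewrite eqxx.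
by apply: le_trans (mleadB_le _ _) _; rewrite rlead joinxx.
Qed.

Lemma zariski_closedP Y : zariski_closed Y ->
  forall x : 'rV[k]_n, (forall p, vanish Y p -> p.@[x ord0] = 0) -> Y x.
Proof. by move=> [I ->] x xP p Ip; apply: xP => y; exact. Qed.

Lemma zariski_closedI_zero Y p :
  zariski_closed Y -> zariski_closed (Y `&` [set x : 'rV[k]_n | p.@[x ord0] = 0]).
Proof.
move=> [I ->]; exists (I `|` [set p]); apply/seteqP; split=> x /=.
  by move=> [Ix px] q [/Ix //| ->].
by move=> Ix; split=> [q Iq|]; apply: Ix; [left|right].
Qed.

(** Counterexamples would form a strictly decreasing sequence of closed sets, hence a strictly
    increasing chain of vanishing ideals. *)
Lemma closed_ind (P : set 'rV[k]_n -> Prop) :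
  (forall Y, zariski_closed Y ->
    (forall Z, zariski_closed Z -> Z `<=` Y -> ~ (Y `<=` Z) -> P Z) -> P Y) ->
  forall Y, zariski_closed Y -> P Y.
Proof.
move=> Pind Y0 Y0c; apply: contrapT => nPY0.
pose bad := {Y | zariski_closed Y /\ ~ P Y}.
have /choice [f fP] : forall Y : bad, exists Z : bad,
    sval Z `<=` sval Y /\ ~ (sval Y `<=` sval Z).
  move=> [Y [Yc nPY]] /=; apply: contrapT => /forallNP nZ.
  apply: nPY; apply: Pind => // Z Zc ZY nYZ; apply: contrapT => nPZ.
  exact: (nZ (exist _ Z (conj Zc nPZ))).
pose S i := iter i f (exist _ Y0 (conj Y0c nPY0)).
have [|||i Ii] := @ideal_chain_stabilizes (fun i => vanish (sval (S i))).
- by move=> i x _; rewrite meval0.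
- by move=> i p q r pv qv x Sx; rewrite mevalB mevalM pv // qv // mulr0 subr0.
- by move=> i p; apply: vanish_sub; have [] := fP (S i).
have [_] := fP (S i); apply => x Sx.
apply: zariski_closedP => [|p]; first by have [] := svalP (f (S i)).
by move=> /(Ii p); apply.
Qed.

(** Adding to the list a polynomial of [I] that does not vanish on the current locus shrinks this
    closed set strictly, so the process stops. Finiteness is what allows [chevalley] to write the
    equations as a formula. *)
Lemma zero_locus_finite (I : set {mpoly k[n]}) :
  exists2 s : seq {mpoly k[n]}, (forall p, p \in s -> I p) &
    forall x : 'rV[k]_n, (forall p, p \in s -> p.@[x ord0] = 0) -> zero_locus I x.
Proof.
suff H Y : zariski_closed Y -> forall s : seq {mpoly k[n]},
    (forall p, p \in s -> I p) -> Y = zero_locus [set` s] ->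
    exists2 s : seq {mpoly k[n]}, (forall p, p \in s -> I p) &
      forall x : 'rV[k]_n, (forall p, p \in s -> p.@[x ord0] = 0) -> zero_locus I x.
  by apply: (H (zero_locus [set` [::]]) _ [::]) => //; eexists.
elim/closed_ind => {}Y Yc IH s sI YE.
have [Is|] := pselect (forall p, I p -> vanish Y p).
  by exists s => // x sx p /Is; apply; rewrite YE.
move=> /existsNP [p /not_implyP [Ip npY]].
apply: (IH (zero_locus [set` p :: s])) (p :: s) _ erefl.
- by eexists.
- rewrite YE => x xp q /= qs; apply: xp => /=.
  by rewrite inE qs orbT.
- move=> sub; apply: npY => x /sub; apply => /=; exact: mem_head.
- by move=> q; rewrite inE => /predU1P[->|/sI].
Qed.

End Noetherian.

(** * Chains of irreducible sets and the Hilbert function *)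

Section Dimension.
Variables (k : fieldType) (M : nat).
Implicit Types (p q : {mpoly k[M]}) (S : set 'rV[k]_M).

(** Primeness of the vanishing ideal makes sense for sets that are not closed, such as the images of
    words. *)
Definition irreducible_points S : Prop :=
  S !=set0 /\ forall p q, vanish S (p * q) -> vanish S p \/ vanish S q.

Lemma msize_mul_le (n : nat) (p q : {mpoly k[n]}) (d e : nat) :
  (msize p <= d.+1)%N -> (msize q <= e.+1)%N -> (msize (p * q) <= (d + e).+1)%N.
Proof.
have [->|p0] := eqVneq p 0; first by rewrite mul0r msize0.
have [->|q0] := eqVneq q 0; first by rewrite mulr0 msize0.
move=> pd qe; rewrite msizeM //.
by rewrite -ltnS prednK ?addn_gt0 ?lt0n ?msize_poly_eq0 ?p0 // -addSn -addnS leq_add.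
Qed.

Lemma msize_exp_le (n : nat) (p : {mpoly k[n]}) (d i : nat) :
  (msize p <= d.+1)%N -> (msize (p ^+ i) <= (i * d).+1)%N.
Proof.
move=> pd; elim: i => [|i IH]; first by rewrite expr0 msize1.
by rewrite exprS mulSn; exact: msize_mul_le.
Qed.

Definition independent_on S (T : finType) (b : T -> {mpoly k[M]}) : Prop :=
  forall a : T -> k, vanish S (\sum_t a t *: b t) -> forall t, a t = 0.

(* If [q] vanishes on [S i] but not on [S i.+1], the products of the powers of [q]
   with a family independent on [S i] are independent on [S i.+1]: the Hilbert
   function of [S m] grows at least like [n ^ m]. *)
Lemma chain_independent (S : nat -> set 'rV[k]_M) (m : nat) :
  (forall i, irreducible_points (S i)) -> (forall i, S i `<=` S i.+1) ->
  (forall i, (i < m)%N -> exists2 q, vanish (S i) q & ~ vanish (S i.+1) q) ->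
  exists c, forall n, exists (T : finType) (b : T -> {mpoly k[M]}),
    [/\ #|T| = (n.+1 ^ m)%N, forall t, (msize (b t) <= (c * n).+1)%N
      & independent_on (S m) b].
Proof.
move=> Sirr Smono; elim: m => [|m IH] qP.
  exists 0 => n; exists unit, (fun=> 1); split.
  - by rewrite card_unit.
  - by move=> _; rewrite msize1.
  move=> a; have [[x Sx] _] := Sirr 0%N => /(_ x Sx).
  by rewrite (big_pred1 tt) => [|[]//]; rewrite mevalZ meval1 mulr1 => + [].
have [i im|c cP] := IH; first by apply: qP; exact: ltnW.
have [q qS nqS] := qP m (ltnSn m).
exists (msize q + c)%N => n; have [T [b [cardT bc bind]]] := cP n.
exists ('I_n.+1 * T)%type, (fun t : 'I_n.+1 * T => q ^+ t.1 * b t.2); split.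
- by rewrite card_prod card_ord cardT expnS.
- move=> [i t] /=; rewrite mulnDl; apply: msize_mul_le => //.
  apply: leq_trans (msize_exp_le _ (leqnSn _)) _.
  by rewrite ltnS mulnC leq_mul2l -ltnS ltn_ord orbT.
move=> a aS.
pose B (i : 'I_n.+1) := \sum_t a (i, t) *: b t.
have aE : \sum_t a t *: (q ^+ t.1 * b t.2) = \sum_(i < n.+1) q ^+ i * B i.
  transitivity (\sum_(i < n.+1) \sum_t a (i, t) *: (q ^+ i * b t)).
    by rewrite pair_bigA; apply: eq_bigr => [[]].
  apply: eq_bigr => i _; rewrite mulr_sumr; apply: eq_bigr => t _.
  by rewrite scalerAr.
suff H j : (j <= n.+1)%N -> forall i : 'I_n.+1, (i < j)%N -> forall t, a (i, t) = 0.
  by move=> [i t]; exact: (H n.+1).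
elim: j => [//|j IHj] jn i; rewrite ltnS leq_eqVlt => /predU1P[ij|]; last first.
  by apply: IHj; exact: ltnW.
(* Once the coefficients of the powers below [j] are zero, [q ^+ j] factors out. It can be cancelled
   on the irreducible [S m.+1], and on [S m], where [q] vanishes, only [B i] remains. *)
apply: bind; pose R := \sum_(l < n.+1 | (j < l)%N) q ^+ (l - j.+1) * B l.
have RE : \sum_(l < n.+1) q ^+ l * B l = q ^+ j * (B i + q * R).
  rewrite (bigID (fun l : 'I_n.+1 => (l < j)%N)) /= big1 ?add0r => [|l lj].
    rewrite (bigD1 i) -?leqNgt ?ij //= mulrDr; congr (_ + _).
    rewrite mulrA -exprSr mulr_sumr; apply: eq_big => l.
      by rewrite -leqNgt ltn_neqAle andbC -val_eqE /= ij eq_sym.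
    rewrite -leqNgt -val_eqE /= ij => /andP[jl lj].
    by rewrite mulrA -exprD subnKC // ltn_neqAle eq_sym lj.
  by rewrite /B big1 ?mulr0 // => t _; rewrite IHj ?scale0r // ltnW.
rewrite aE RE in aS.
have nqX l : ~ vanish (S m.+1) (q ^+ l).
  elim: l => [|l IHl]; last first.
    by rewrite exprS => /(Sirr m.+1).2 [|].
  have [[x Sx] _] := Sirr m.+1 => /(_ x Sx) /eqP.
  by rewrite expr0 meval1 oner_eq0.
have [/nqX//|BR] := (Sirr m.+1).2 _ _ aS.
move=> x Sx; have := BR x (Smono _ _ Sx).
by rewrite mevalD mevalM qS // mul0r addr0.
Qed.

Lemma card_bmultinom d : (#|{: 'X_{1..M < d}}| <= d ^ M)%N.
Proof.
have lt (m : 'X_{1..M < d}) i : ((m : 'X_{1..M}) i < d)%N.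
  by apply: leq_ltn_trans (bmdeg m); rewrite mdegE (bigD1 i) //= leq_addr.
pose f (m : 'X_{1..M < d}) : {ffun 'I_M -> 'I_d} := [ffun i => Ordinal (lt m i)].
have finj : injective f.
  move=> m m' /ffunP mm; apply: val_inj; apply/mnmP => i.
  by have := mm i; rewrite !ffunE => -[].
by have := leq_card f finj; rewrite card_ffun !card_ord.
Qed.

Lemma independent_card S d (T : finType) (b : T -> {mpoly k[M]}) :
  (forall t, (msize (b t) <= d)%N) -> independent_on S b -> (#|T| <= d ^ M)%N.
Proof.
move=> bd bind; apply: leq_trans (card_bmultinom d).
pose C : 'M[k]_(#|T|, #|{: 'X_{1..M < d}}|) :=
  \matrix_(i, j) (b (enum_val i))@_(bmnm (enum_val j)).
suff /eqP <- : row_free C by exact: rank_leq_col.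
rewrite -kermx_eq0; apply/eqP/row_matrixP => l; rewrite row0.
have := row_sub l (kermx C); set a := row l _ => /sub_kermxP aC.
apply/rowP => i; rewrite [RHS]mxE.
rewrite -(enum_valK i); apply: (bind (fun t => a ord0 (enum_rank t))) => x _.
suff -> : \sum_t a ord0 (enum_rank t) *: b t = 0 by rewrite meval0.
apply/mpolyP => m; rewrite mcoeff0 raddf_sum /=.
have [md|md] := ltnP (mdeg m) d; last first.
  rewrite big1 // => t _; rewrite mcoeffZ memN_msupp_eq0 ?mulr0 //.
  by apply: msize_mdeg_ge; exact: leq_trans (bd t) md.
have /rowP /(_ (enum_rank (BMultinom md))) := aC.
rewrite [LHS]mxE [RHS]mxE => aCm; rewrite -[RHS]aCm.
rewrite (reindex (fun i : 'I_#|T| => enum_val i)); last first.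
  exact: onW_bij (@enum_val_bij T).
apply: eq_bigr => j _; rewrite mcoeffZ enum_valK; congr (_ * _).
by rewrite mxE enum_rankK.
Qed.

Lemma chain_stabilizes (S : nat -> set 'rV[k]_M) :
  (forall i, irreducible_points (S i)) -> (forall i, S i `<=` S i.+1) ->
  exists2 n, (n <= M)%N & forall p, vanish (S n) p -> vanish (S n.+1) p.
Proof.
move=> Sirr Smono; apply: contrapT => nst.
have [i iM|c cP] := chain_independent (m := M.+1) Sirr Smono.
  apply: contrapT => nq; apply: nst; exists i => // p pi.
  by apply: contrapT => np; apply: nq; exists p.
(* For [n = (c + 1) ^ M], the upper bound [(c n + 1) ^ M <= (c + 1) ^ M (n + 1) ^ M = n (n + 1) ^ M]
   is less than the number [(n + 1) ^ (M + 1)] of independent polynomials that [M + 1] strict steps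
   would give. *)
have [T [b [cardT bc /(independent_card bc)]]] := cP ((c.+1 ^ M)%N).
rewrite cardT expnS leqNgt => /negP; apply.
set n := (c.+1 ^ M)%N.
apply: (@leq_ltn_trans (n * n.+1 ^ M)); last first.
  by rewrite ltn_pmul2r // expn_gt0.
have leq_expn e a b' : (a <= b')%N -> (a ^ e <= b' ^ e)%N.
  by move=> ab; elim: e => // e IHe; rewrite !expnS leq_mul.
rewrite /n -expnMn; apply: leq_expn; rewrite -/n mulSn mulnS -add1n.
by rewrite leq_add ?leq_addl.
Qed.

End Dimension.

(** * Interpolation of polynomials on [X] *)

Section Interpolation.
Variables (k : fieldType) (N : nat) (X : set 'rV[k]_N).

(** The points are chosen so that their vectors of monomial values form a basis of the span of all
    such vectors; the [t i] are the dual coordinates, read off a pseudo-inverse. A polynomial of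
    degree below [D] is thus determined on [X] by finitely many values. *)
Lemma interpolation (D : nat) : exists (r : nat) (x : 'I_r -> X)
    (t : 'I_r -> {mpoly k[N]}),
  [/\ forall i, (msize (t i) <= D)%N,
      forall i j, (t i).@[val (x j) ord0] = (i == j)%:R
    & forall p, (msize p <= D)%N -> forall y : X,
        p.@[val y ord0] = \sum_i p.@[val (x i) ord0] * (t i).@[val y ord0]].
Proof.
pose mon (j : 'I_#|{: 'X_{1..N < D}}|) := bmnm (enum_val j).
pose phi (y : X) : 'rV[k]_#|{: 'X_{1..N < D}}| :=
  \row_j ('X_[k, mon j]).@[val y ord0].
have [r [x [_ Bfree Bsub]]] := exists_row_basis [set: X] phi.
set B := \matrix_i _ in Bfree Bsub.
pose t i := \sum_j (pinvmx B) j i *: 'X_[k, mon j].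
have tE i (y : X) : (t i).@[val y ord0] = (phi y *m pinvmx B) ord0 i.
  rewrite /t raddf_sum mxE; apply: eq_bigr => j _ /=.
  by rewrite mevalZ [RHS]mulrC; congr (_ * _); rewrite mxE.
exists r, x, t; split.
- move=> i; apply: leq_trans (msize_sum _ _ _) _.
  apply/bigmax_leqP => j _; apply: leq_trans (msizeZ_le _ _) _.
  by rewrite msizeX; exact: bmdeg.
- move=> i j; rewrite tE.
  have -> : phi (x j) = row j B by rewrite rowK.
  by rewrite -row_mul mulmxVp // mxE mxE eq_sym.
move=> p pD y.
pose c : 'cV[k]_#|{: 'X_{1..N < D}}| := \col_j p@_(mon j).
have pE (z : X) : p.@[val z ord0] = (phi z *m c) ord0 ord0.
  rewrite [in LHS](mpolywE pD) raddf_sum mxE.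
  rewrite (reindex (fun j : 'I_#|{: 'X_{1..N < D}}| => enum_val j)) /=; last first.
    exact: onW_bij (@enum_val_bij _).
  by apply: eq_bigr => j _; rewrite mevalZ !mxE mulrC.
rewrite pE -[in LHS](mulmxKpV (Bsub y I)) -mulmxA mxE; apply: eq_bigr => i _.
rewrite tE mulrC; congr (_ * _); rewrite pE [LHS]mxE [RHS]mxE.
by apply: eq_bigr => j _; congr (_ * _); rewrite mxE.
Qed.

End Interpolation.

(** * Regular functions on the automorphism group *)

Section RegularFunctions.
Variables (k : fieldType) (N : nat) (X : set 'rV[k]_N).
Local Notation Aut := (aut X).

(** These are the polynomials in the coordinates of values of [f] and [f^-1] at points of [X]. They
    are stable under translation and inversion, and their zero sets are closed by
    [regfun_zeros_closed]. *)
Inductive regfun : (Aut -> k) -> Prop :=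
| regfun_const c : regfun (fun=> c)
| regfun_eval (x : X) i : regfun (fun f => val (f x) ord0 i)
| regfun_evalV (x : X) i : regfun (fun f => val ((f^-1)%g x) ord0 i)
| regfunD a b : regfun a -> regfun b -> regfun (fun f => a f + b f)
| regfunM a b : regfun a -> regfun b -> regfun (fun f => a f * b f).

Lemma regfun_sum (I : Type) (r : seq I) (P : pred I) (a : I -> Aut -> k) :
  (forall i, regfun (a i)) -> regfun (fun f => \sum_(i <- r | P i) a i f).
Proof.
move=> ra; elim: r => [|i r IH].
  by under eq_fun do rewrite big_nil; exact: regfun_const.
under eq_fun do rewrite big_cons; case: (P i) => //.
exact: regfunD.
Qed.

Lemma regfun_prod (I : Type) (r : seq I) (P : pred I) (a : I -> Aut -> k) :
  (forall i, regfun (a i)) -> regfun (fun f => \prod_(i <- r | P i) a i f).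
Proof.
move=> ra; elim: r => [|i r IH].
  by under eq_fun do rewrite big_nil; exact: regfun_const.
under eq_fun do rewrite big_cons; case: (P i) => //.
exact: regfunM.
Qed.

Lemma regfunX a n : regfun a -> regfun (fun f => a f ^+ n).
Proof.
move=> ra; elim: n => [|n IH].
  by under eq_fun do rewrite expr0; exact: regfun_const.
by under eq_fun do rewrite exprS; exact: regfunM.
Qed.

Lemma regfun_meval (n : nat) (p : {mpoly k[n]}) (c : 'I_n -> Aut -> k) :
  (forall i, regfun (c i)) -> regfun (fun f => p.@[fun i => c i f]).
Proof.
move=> rc; under eq_fun do rewrite mevalE.
apply: regfun_sum => m; apply: regfunM; first exact: regfun_const.
by apply: regfun_prod => i; exact: regfunX.
Qed.

Lemma regfun_comb (m : nat) (a : 'I_m -> Aut -> k) (c : 'I_m -> k) :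
  (forall i, regfun (a i)) -> regfun (fun g => \sum_i c i * a i g).
Proof.
by move=> ra; apply: regfun_sum => i; apply: regfunM => //; exact: regfun_const.
Qed.

Lemma regfun_comp_eval (g : Aut) (x : X) i :
  regfun (fun f => val (g (f x)) ord0 i).
Proof.
have [P Pg] := aut_fun_regular g.
under eq_fun do rewrite Pg.
by apply: regfun_meval => j; exact: regfun_eval.
Qed.

Lemma regfun_comp_evalV (g : Aut) (x : X) i :
  regfun (fun f => val (g ((f^-1)%g x)) ord0 i).
Proof.
have [P Pg] := aut_fun_regular g.
under eq_fun do rewrite Pg.
by apply: regfun_meval => j; exact: regfun_evalV.
Qed.

Lemma regfun_mull (g : Aut) a : regfun a -> regfun (fun f => a (g * f)%g).
Proof.
elim=> {a} [c|x i|x i|a b _ IHa _ IHb|a b _ IHa _ IHb].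
- exact: regfun_const.
- exact: regfun_comp_eval.
- by under eq_fun do rewrite invgM; exact: regfun_evalV.
- exact: regfunD.
- exact: regfunM.
Qed.

Lemma regfun_mulr (g : Aut) a : regfun a -> regfun (fun f => a (f * g)%g).
Proof.
elim=> {a} [c|x i|x i|a b _ IHa _ IHb|a b _ IHa _ IHb].
- exact: regfun_const.
- exact: regfun_eval.
- by under eq_fun do rewrite invgM; exact: regfun_comp_evalV.
- exact: regfunD.
- exact: regfunM.
Qed.

Lemma regfun_inv a : regfun a -> regfun (fun f => a (f^-1)%g).
Proof.
elim=> {a} [c|x i|x i|a b _ IHa _ IHb|a b _ IHa _ IHb].
- exact: regfun_const.
- exact: regfun_evalV.
- by under eq_fun do rewrite invgK; exact: regfun_eval.
- exact: regfunD.
- exact: regfunM.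
Qed.

Lemma exists_regular_fun_basis d :
  exists (m : nat) (e : 'I_m -> X -> k), regular_fun_basis d e.
Proof.
have [r [x [t [tD tx tp]]]] := interpolation X d.+1.
exists r, (fun j (y : X) => (t j).@[val y ord0]); split.
- by move=> j; exists (t j).
- move=> c c0; apply/rowP => j; have := c0 (x j).
  rewrite (bigD1 j) //= tx eqxx mulr1 big1 ?addr0 ?mxE // => i ij.
  by rewrite tx (negPf ij) mulr0.
- move=> u [p pd up]; exists (\row_j p.@[val (x j) ord0]) => y.
  by rewrite up tp //; apply: eq_bigr => j _; rewrite mxE.
Qed.

Definition represents_on d (m : nat) (e : 'I_m -> X -> k)
    (P : {mpoly k[(N + N) * m]}) (a : Aut -> k) : Prop :=
  forall (f : Aut) (A B : 'M[k]_(N, m)), aut_le d f ->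
    coordinates e f A -> coordinates e (f^-1)%g B ->
    a f = P.@[mxvec (col_mx A B) ord0].

Lemma regfun_represented d (m : nat) (e : 'I_m -> X -> k) a :
  regfun a -> exists P, represents_on d e P a.
Proof.
elim=> {a} [c|x i|x i|a b _ [P Pa] _ [Q Qb]|a b _ [P Pa] _ [Q Qb]].
- by exists c%:MP => f A B _ _ _; rewrite mevalC.
- exists (\sum_j e j x *: 'X_(mxvec_index (lshift N i) j)) => f A B _ fA _.
  rewrite fA raddf_sum; apply: eq_bigr => j _ /=.
  by rewrite mevalZ mevalXU mxvecE col_mxEu mulrC.
- exists (\sum_j e j x *: 'X_(mxvec_index (rshift N i) j)) => f A B _ _ fB.
  rewrite fB raddf_sum; apply: eq_bigr => j _ /=.
  by rewrite mevalZ mevalXU mxvecE col_mxEd mulrC.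
- by exists (P + Q) => f A B fd fA fB; rewrite mevalD (Pa f A B) ?(Qb f A B).
- by exists (P * Q) => f A B fd fA fB; rewrite mevalM (Pa f A B) ?(Qb f A B).
Qed.

Lemma regfun_zeros_closed (J : set (Aut -> k)) : J `<=` regfun ->
  aut_closed [set f : Aut | forall a, J a -> a f = 0].
Proof.
move=> Jreg d; have [m [e eb]] := exists_regular_fun_basis d.
exists m, e; split=> //.
exists (zero_locus [set P | exists2 a, J a & represents_on d e P a]).
  by eexists.
move=> f A B fd fA fB; split=> [Sf P [a Ja Pa]|Z a Ja].
  by rewrite -(Pa f A B) // Sf.
have [P Pa] := regfun_represented d e (Jreg _ Ja).
by rewrite (Pa f A B) //; apply: Z; exists a.
Qed.

Definition regfun_irreducible (S : set Aut) : Prop :=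
  S !=set0 /\ forall a b, regfun a -> regfun b ->
    (forall f, S f -> a f * b f = 0) ->
    (forall f, S f -> a f = 0) \/ (forall f, S f -> b f = 0).

Lemma irreducible_regfun (S : set Aut) :
  irreducible_subset S -> regfun_irreducible S.
Proof.
move=> [S0 Sirr]; split=> // a b ra rb ab.
have cl c : regfun c -> aut_closed [set f : Aut | c f = 0].
  move=> rc; rewrite (_ : [set f | c f = 0] =
    [set f : Aut | forall a, [set c] a -> a f = 0]).
    by apply: regfun_zeros_closed => _ ->.
  by apply/seteqP; split=> f /=; [move=> cf _ ->|apply].
have [|Sa|Sb] := Sirr _ _ (cl a ra) (cl b rb); [|by left|by right].
move=> f /ab /eqP; rewrite mulf_eq0 => /orP[/eqP|/eqP]; first by left.
by right.
Qed.

Lemma regfun_irreducible1 : regfun_irreducible [set 1%g].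
Proof.
split; first by exists 1%g.
move=> a b _ _ /(_ 1%g erefl) /eqP; rewrite mulf_eq0.
by case/orP => /eqP ab; [left|right] => _ ->.
Qed.

(** Regularity in each factor separately is enough: irreducibility of [S] gives one [s] at which
    neither [a (u va * s)] nor [b (u vb * s)] vanishes, and irreducibility of [V] then gives one [v]
    for this [s]. Taking [u] to be the identity or inversion covers both halves of a letter. *)
Lemma regfun_irreducible_mul (V S : set Aut) (u : Aut -> Aut) :
  (forall a s, regfun a -> regfun (fun v => a (u v * s)%g)) ->
  regfun_irreducible V -> regfun_irreducible S ->
  regfun_irreducible [set g | exists v s, [/\ V v, S s & g = (u v * s)%g]].
Proof.
move=> ureg [[v0 Vv0] Virr] [[s0 Ss0] Sirr]; split.
  by exists (u v0 * s0)%g, v0, s0.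
move=> a b ra rb ab; apply: contrapT => /not_orP [na nb].
have neg (c : Aut -> k) : ~ (forall f, [set g | exists v s,
    [/\ V v, S s & g = (u v * s)%g]] f -> c f = 0) ->
    exists v s, [/\ V v, S s & c (u v * s)%g <> 0].
  move=> /existsNP [f /not_implyP [[v [s [Vv Ss ->]]] cf]].
  by exists v, s.
have [va [sa [Vva Ssa asa]]] := neg _ na.
have [vb [sb [Vvb Ssb bsb]]] := neg _ nb.
have [s Ss [as0 bs0]] : exists2 s, S s & a (u va * s)%g <> 0 /\ b (u vb * s)%g <> 0.
  apply: contrapT => ns.
  have [|H|H] := Sirr _ _ (regfun_mull (u va) ra) (regfun_mull (u vb) rb).
  - move=> s Ss; apply/eqP; rewrite mulf_eq0; apply: contraT.
    rewrite negb_or => /andP[/eqP ? /eqP ?]; exfalso; apply: ns.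
    by exists s.
  - by apply: asa; exact: H.
  - by apply: bsb; exact: H.
have [|H|H] := Virr _ _ (ureg a s ra) (ureg b s rb).
- by move=> v Vv; apply: ab; exists v, s.
- by apply: as0; exact: H.
- by apply: bs0; exact: H.
Qed.

Lemma regfun_irreducible_word (V : set Aut) n :
  regfun_irreducible V -> regfun_irreducible (word V n).
Proof.
move=> Virr; elim: n => [|n IH]; first exact: regfun_irreducible1.
have := regfun_irreducible_mul _ Virr
  (regfun_irreducible_mul (u := fun w => w^-1)%g _ Virr IH) (u := id).
rewrite (_ : [set g | _] = word V n.+1); last first.
  apply/seteqP; split=> g /=.
    by move=> [v [_ [Vv [w [h [Vw wh ->]]] ->]]]; exists v, w, h; rewrite mulgA.
  move=> [v [w [h [Vv Vw wh ->]]]]; exists v, (w^-1 * h)%g; rewrite mulgA.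
  by split=> //; exists w, h.
apply=> [a s|a s] ra; first exact: regfun_mulr.
exact: (regfun_inv (regfun_mulr s ra)).
Qed.

End RegularFunctions.

(** * Density of words of bounded length *)

Section Density.
Variables (k : fieldType) (N : nat) (X : set 'rV[k]_N).
Local Notation Aut := (aut X).
Variables (m : nat) (x : 'I_m -> X).

Definition values (f : Aut) : 'rV[k]_(m * N) :=
  mxvec (\matrix_(i < m, j < N) val (f (x i)) ord0 j).

Definition values_poly (a : Aut -> k) : Prop :=
  exists p : {mpoly k[m * N]}, forall f, a f = p.@[values f ord0].

Lemma valuesE f i j : values f ord0 (mxvec_index i j) = val (f (x i)) ord0 j.
Proof. by rewrite mxvecE mxE. Qed.

Lemma values_poly_eval (g : Aut) i j :
  values_poly (fun f => val (g (f (x i))) ord0 j).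
Proof.
have [P Pg] := aut_fun_regular g.
exists (P j \mPo [tuple 'X_(mxvec_index i l) | l < N]) => f.
rewrite Pg comp_mpoly_meval; apply: meval_eq => l.
by rewrite tnth_map tnth_ord_tuple mevalXU valuesE.
Qed.

Lemma values_poly_comb (q : nat) a (c : 'I_q -> k) (b : 'I_q -> Aut -> k) :
  values_poly a -> (forall j, values_poly (b j)) ->
  values_poly (fun f => a f - \sum_j c j * b j f).
Proof.
move=> [p pa] /choice [Q QP]; exists (p - \sum_j c j *: Q j) => f.
rewrite mevalB -pa; congr (_ - _); rewrite raddf_sum; apply: eq_bigr => j _ /=.
by rewrite mevalZ -QP.
Qed.

Lemma values_poly_mull (g : Aut) a :
  values_poly a -> values_poly (fun f => a (g * f)%g).
Proof.
move=> [p pa].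
have /choice [Q QP] : forall l, exists q : {mpoly k[m * N]},
    forall f, values (g * f)%g ord0 l = q.@[values f ord0].
  move=> l; case/mxvec_indexP: l => i j.
  have [q qP] := values_poly_eval g i j; exists q => f.
  by rewrite valuesE -qP.
exists (p \mPo [tuple Q l | l < m * N]) => f.
rewrite pa comp_mpoly_meval; apply: meval_eq => l.
by rewrite tnth_map tnth_ord_tuple QP.
Qed.

Lemma regfun_values (p : {mpoly k[m * N]}) :
  regfun (fun f => p.@[values f ord0]).
Proof.
have -> : (fun f => p.@[values f ord0]) =
  (fun f => p.@[fun l => (fun f => values f ord0 l) f]) by [].
apply: regfun_meval => l; case/mxvec_indexP: l => i j.
by under eq_fun do rewrite valuesE; exact: regfun_eval.
Qed.

Lemma irreducible_values (S : set Aut) :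
  regfun_irreducible S -> irreducible_points [set values f | f in S].
Proof.
move=> [[f0 Sf0] Sirr]; split; first by exists (values f0), f0.
move=> p q pq.
have [|H|H] := Sirr _ _ (regfun_values p) (regfun_values q).
- by move=> f Sf; rewrite -mevalM; apply: pq; exists f.
- by left=> _ [f Sf <-]; exact: H.
- by right=> _ [f Sf <-]; exact: H.
Qed.

Variable V : set Aut.
Hypotheses (Virr : regfun_irreducible V) (V1 : V 1%g).

(** The values at [m] points lie in a space of dimension [m * N], so two consecutive closures agree
    at some [n <= m * N]. Left translations act polynomially on values and carry this equality on to
    all longer words. *)
Lemma word_dense a : values_poly a ->
  (forall f, word V (m * N) f -> a f = 0) ->
  forall f, subgroup_generated V f -> a f = 0.
Proof.
pose S n := [set values f | f in word V n].
have Smono i j : (i <= j)%N -> S i `<=` S j.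
  by move=> ij _ [f wf <-]; exists f => //; exact: (word_le V1 ij).
have [i|n nM nst] := @chain_stabilizes _ _ S _ (fun i => Smono _ _ (leqnSn i)).
  exact: irreducible_values (regfun_irreducible_word _ Virr).
pose st n := forall a, values_poly a -> (forall f, word V n f -> a f = 0) ->
  forall f, word V n.+1 f -> a f = 0.
have st_n : st n.
  move=> b [p pb] bn f wf; rewrite pb; apply: nst; last by exists f.
  by move=> _ [g wg <-]; rewrite -pb bn.
have stS i : st i -> st i.+1.
  move=> sti b bp bi _ [v [w [h [Vv Vw wh ->]]]].
  apply: (sti _ (values_poly_mull (v * w^-1)%g bp)) wh => f wf.
  by apply: bi; exists v, w, f.
have st_all d : st (d + n)%N by elim: d => //= d IH; exact: stS.
move=> ap aM; rewrite subgroup_generated_word // => f [i wf].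
suff H d : forall f, word V (d + n) f -> a f = 0.
  by apply: (H i); apply: (word_le V1 _ wf); exact: leq_addr.
elim: d => [|d IH]; last exact: (st_all d).
by move=> g /(word_le V1 nM); exact: aM.
Qed.

End Density.

(** * Degrees and ranks of orbits *)

Section Degrees.
Variables (k : fieldType) (N : nat) (X : set 'rV[k]_N).
Local Notation Aut := (aut X).

Lemma msize_comp_le (m n : nat) (p : {mpoly k[m]}) (q : m.-tuple {mpoly k[n]})
    (d e : nat) : (msize p <= d.+1)%N ->
  (forall i, (msize (tnth q i) <= e.+1)%N) -> (msize (p \mPo q) <= (d * e).+1)%N.
Proof.
move=> pd qe; rewrite comp_mpolyE.
apply: leq_trans (msize_sum _ _ _) _.
apply/bigmax_leqP_seq => mm mp _; apply: leq_trans (msizeZ_le _ _) _.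
have md : (mdeg mm <= d)%N by rewrite -ltnS; exact: leq_trans (msize_mdeg_lt mp) pd.
apply: (@leq_trans (mdeg mm * e).+1); last by rewrite ltnS leq_mul2r md orbT.
rewrite mdegE big_distrl /=.
elim/big_rec2: _ => [|i a b _ ab]; first by rewrite msize1.
apply: msize_mul_le => //; exact: msize_exp_le.
Qed.

Lemma degree_le_comp d e (phi psi : X -> X) :
  degree_le d phi -> degree_le e psi -> degree_le (d * e) (phi \o psi).
Proof.
move=> [P Pd Pphi] [Q Qe Qpsi].
exists (fun i => P i \mPo [tuple Q j | j < N]) => [i|x i].
  by apply: msize_comp_le => // j; rewrite tnth_map tnth_ord_tuple.
rewrite /= Pphi comp_mpoly_meval; apply: meval_eq => j.
by rewrite tnth_map tnth_ord_tuple Qpsi.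
Qed.

Lemma aut_le_mul d e (f g : Aut) :
  aut_le d f -> aut_le e g -> aut_le (d * e) (f * g)%g.
Proof.
move=> [fd fVd] [ge gVe]; split; first exact: degree_le_comp.
by rewrite invgM mulnC; exact: degree_le_comp.
Qed.

Lemma aut_le_inv d (f : Aut) : aut_le d f -> aut_le d (f^-1)%g.
Proof. by move=> [fd fVd]; split; rewrite ?invgK. Qed.

Lemma aut_le1 : aut_le 1 (1%g : Aut).
Proof.
suff H : degree_le 1 (id : X -> X) by split; rewrite ?invg1.
by exists (fun i => 'X_i) => [i|x i]; rewrite ?msizeX ?mdeg1 ?mevalXU.
Qed.

Lemma aut_le_exists (f : Aut) : exists d, aut_le d f.
Proof.
have H (phi : X -> X) : regular_map phi -> exists d, degree_le d phi.
  move=> [P Pphi]; exists (\max_i msize (P i)); exists P => // i.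
  by apply: leqW; exact: leq_bigmax.
have [d fd] := H _ (aut_fun_regular f).
have [e fe] := H _ (aut_inv_regular f).
have mono d' e' phi : (d' <= e')%N -> degree_le d' phi -> @degree_le k N X e' phi.
  by move=> de [P Pd Pf]; exists P => // i; exact: leq_trans (Pd i) _.
exists (maxn d e); split; first exact: mono (leq_maxl _ _) fd.
exact: mono (leq_maxr _ _) fe.
Qed.

Lemma word_aut_le (V : set Aut) d : V `<=` aut_le d ->
  forall n, exists D, word V n `<=` aut_le D.
Proof.
move=> Vd; elim=> [|n [D IH]]; first by exists 1%N => _ ->; exact: aut_le1.
exists (d * d * D)%N => _ [v [w [h [/Vd Vv /Vd Vw /IH wh ->]]]].
by apply: aut_le_mul => //; apply: aut_le_mul => //; exact: aut_le_inv.
Qed.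

Lemma interpolation_aut D : exists (r : nat) (x : 'I_r -> X)
    (t : 'I_r -> {mpoly k[N]}),
  [/\ forall i, (msize (t i) <= D.+1)%N,
      forall i j, (t i).@[val (x j) ord0] = (i == j)%:R
    & forall f : Aut, aut_le D f -> forall (y : X) i,
        val (f y) ord0 i = \sum_l val (f (x l)) ord0 i * (t l).@[val y ord0]].
Proof.
have [r [x [t [tD tx tp]]]] := interpolation X D.+1.
exists r, x, t; split=> // f [[P PD Pf] _] y i.
by rewrite Pf tp //; apply: eq_bigr => l _; rewrite Pf.
Qed.

End Degrees.

Section OrbitRank.
Variables (k : fieldType) (N : nat) (X : set 'rV[k]_N).
Local Notation Aut := (aut X).
Variables (V : set Aut) (d : nat).
Hypotheses (Vcomm : commutative_subset V) (Virr : regfun_irreducible V).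
Hypotheses (V1 : V 1%g) (Vd : V `<=` aut_le d).
Local Notation Gamma := (subgroup_generated V).

(* On the orbit of [y], every [gamma] in [Gamma] agrees with a combination of
   the elements of [word V N], and [word V N] has bounded degree. *)
Lemma orbit_rank (i : 'I_N) : exists (r : nat) (t : 'I_r -> {mpoly k[N]}),
  forall (y : X) gamma, Gamma gamma -> exists c : 'I_r -> k,
    forall g, Gamma g ->
      val (gamma (g y)) ord0 i = \sum_l (t l).@[val (g y) ord0] * c l.
Proof.
(* The length [1 * N] is that of [word_dense] for the single point [y]. The degree bound [D], and
   with it [r] and [t], is fixed before [y], which makes the rank uniform. *)
have [D wD] := word_aut_le Vd (1 * N).
have [r [x [t [tD tx tf]]]] := interpolation_aut X D.
exists r, t => y gamma Ggamma.
pose phi (g : Aut) : 'rV[k]_r := \row_l (t l).@[val (g y) ord0].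
have [q [g [Gg Bfree Bsub]]] := exists_row_basis Gamma phi.
set B := \matrix_(_ < q) _ in Bfree Bsub.
pose u (h g : Aut) := val (h (g y)) ord0 i.
pose s g0 := phi g0 *m pinvmx B.
have Gcomm := subgroup_generated_commutative Vcomm.
have swap h g0 : Gamma h -> Gamma g0 -> u h g0 = val (g0 (h y)) ord0 i.
  by move=> Gh Gg0; rewrite /u -[h (g0 y)]/((h * g0)%g y) Gcomm.
have sB g0 : Gamma g0 -> s g0 *m B = phi g0.
  by move=> Gg0; rewrite /s mulmxKpV // Bsub.
have wE h g0 : word V (1 * N) h -> u h g0 = \sum_l phi g0 ord0 l * val (h (x l)) ord0 i.
  move=> /wD hD; rewrite /u tf //; apply: eq_bigr => l _.
  by rewrite mxE mulrC.
have wu h g0 : word V (1 * N) h -> Gamma g0 ->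
    u h g0 = \sum_j s g0 ord0 j * u h (g j).
  move=> wh Gg0; rewrite wE // -(sB g0) //.
  under eq_bigr do rewrite mxE mulr_suml.
  rewrite exchange_big /=; apply: eq_bigr => j _.
  rewrite wE // mulr_sumr; apply: eq_bigr => l _.
  by rewrite -mulrA; congr (_ * (_ * _)); rewrite [LHS]mxE.
have wG h : word V (1 * N) h -> Gamma h.
  by move=> wh; rewrite subgroup_generated_word //; exists (1 * N)%N.
(* For fixed [g0] the swapped expression is polynomial in [h y], so a linear relation verified on
   words of length [N] extends by density to all [h] in [Gamma]. *)
have uE h g0 : Gamma h -> Gamma g0 -> u h g0 = \sum_j s g0 ord0 j * u h (g j).
  move=> Gh Gg0; apply/eqP; rewrite -subr_eq0; apply/eqP.
  pose a (h : Aut) := val (g0 (h y)) ord0 i -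
    \sum_j s g0 ord0 j * val (g j (h y)) ord0 i.
  have aE f : Gamma f -> u f g0 - \sum_j s g0 ord0 j * u f (g j) = a f.
    by move=> Gf; rewrite swap //; congr (_ - _); apply: eq_bigr => j _; rewrite swap.
  rewrite aE //; apply: (@word_dense _ _ _ 1 (fun=> y) V Virr V1 a) Gh.
  - apply: values_poly_comb => [|j];
      exact: (values_poly_eval (fun=> y) _ ord0 i).
  - by move=> f wf; rewrite -aE ?wu ?subrr //; exact: wG.
pose ug : 'cV[k]_q := \col_j u gamma (g j).
exists (fun l => (pinvmx B *m ug) l ord0) => g0 Gg0.
rewrite -[LHS]/(u gamma g0) uE //.
transitivity ((s g0 *m ug) ord0 ord0).
  by rewrite mxE; apply: eq_bigr => j _; rewrite [ug _ _]mxE.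
transitivity ((phi g0 *m (pinvmx B *m ug)) ord0 ord0).
  by rewrite mulmxA.
by rewrite mxE; apply: eq_bigr => l _; rewrite [phi _ _ _]mxE.
Qed.

End OrbitRank.

(** * Functions of finite rank as matrix coefficients *)

Section FiniteRank.
Variables (L : fieldType) (G : groupType) (V : set G).
Local Notation Gamma := (subgroup_generated V).

(** If the values of [c] had rank less than [n], [c] would factor through fewer coordinates, against
    minimality. *)
Lemma exists_mx_basis (n : nat) (c : G -> 'rV[L]_n) :
  (forall (r : nat) (c' : G -> 'rV[L]_r) (B : 'M[L]_(r, n)),
    (forall g, Gamma g -> c g = c' g *m B) -> (n <= r)%N) ->
  exists t : 'I_n -> G, (forall i, Gamma (t i)) /\ \matrix_i c (t i) \in unitmx.
Proof.
move=> nmin; have [r [t [Gt Bfree Bsub]]] := exists_row_basis Gamma c.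
have rn : (r <= n)%N by rewrite -(eqP (Bfree : \rank _ == _)) rank_leq_col.
have nr : (n <= r)%N.
  apply: (nmin r (fun g => c g *m pinvmx (\matrix_i c (t i))) (\matrix_i c (t i))).
  by move=> g Gg; rewrite mulmxKpV ?Bsub.
have {rn nr} rn : r = n by apply/eqP; rewrite eqn_leq rn.
by subst r; exists t; split=> //; rewrite -row_free_unit.
Qed.

(** In a factorization [h (a * b) = c a * e b] of least size the vectors [c a] and [e b] span, and
    translation induces [rho] with [rho g *m e b = e (g * b)]. The last clause writes [rho g]
    through values of [h], from which its entries will inherit the form of an algebraic family. *)
Lemma finite_rank_representation (h : G -> L) (n0 : nat)
    (c0 : G -> 'rV[L]_n0) (e0 : G -> 'cV[L]_n0) :
  (forall a b, Gamma a -> Gamma b -> h (a * b)%g = (c0 a *m e0 b) ord0 ord0) ->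
  exists (n : nat) (rho : G -> 'M[L]_n) (p : 'rV[L]_n) (q : 'cV[L]_n),
    [/\ rho 1%g = 1%:M,
        forall a b, Gamma a -> Gamma b -> rho (a * b)%g = rho a *m rho b,
        forall g, Gamma g -> h g = (p *m rho g *m q) ord0 ord0
      & exists (C E : 'M[L]_n) (x y : 'I_n -> G),
          [/\ forall i, Gamma (x i), forall i, Gamma (y i)
            & forall g, Gamma g ->
                rho g = C *m (\matrix_(i, j) h (x i * g * y j)%g) *m E]].
Proof.
have [G1 GM GI] := subgroup_generated_subgroup V.
move=> he0.
pose P n := `[< exists (c : G -> 'rV[L]_n) (e : G -> 'cV[L]_n),
  forall a b, Gamma a -> Gamma b -> h (a * b)%g = (c a *m e b) ord0 ord0 >].
have exP : exists n, P n by exists n0; apply/asboolP; exists c0, e0.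
case: (ex_minnP exP) => n /asboolP [c [e he]] nmin.
have [x [Gx Cu]] : exists x : 'I_n -> G,
    (forall i, Gamma (x i)) /\ \matrix_i c (x i) \in unitmx.
  apply: exists_mx_basis => r c' B cB; apply: nmin; apply/asboolP.
  by exists c', (fun g => B *m e g) => a b Ga Gb; rewrite he // cB // mulmxA.
have [y [Gy Eu]] : exists y : 'I_n -> G,
    (forall i, Gamma (y i)) /\ \matrix_i (e (y i))^T \in unitmx.
  apply: (exists_mx_basis (c := fun g => (e g)^T)) => r e' B eB.
  apply: nmin; apply/asboolP.
  exists (fun g => c g *m B^T), (fun g => (e' g)^T) => a b Ga Gb.
  by rewrite he // -mulmxA -trmx_mul -eB // trmxK.
set C := \matrix_i c (x i) in Cu.
pose E := (\matrix_i (e (y i))^T)^T.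
have {}Eu : E \in unitmx by rewrite unitmx_tr.
have colE j : col j E = e (y j) by rewrite -tr_row rowK trmxK.
have CE a i : Gamma a -> (C *m e a) i ord0 = h (x i * a)%g.
  by move=> Ga; rewrite he // !mxE; apply: eq_bigr => l _; rewrite mxE.
pose H g : 'M[L]_n := \matrix_(i, j) h (x i * g * y j)%g.
pose rho g := invmx C *m H g *m invmx E.
have rhoe g a : Gamma g -> Gamma a -> rho g *m e a = e (g * a)%g.
  move=> Gg Ga.
  pose C1 : 'M[L]_n := \matrix_i c (x i * g)%g.
  have HE : H g = C1 *m E.
    apply/matrixP => i j; rewrite mxE he ?(GM _ _ _ _) //; last exact: GM.
    rewrite -colE !mxE; apply: eq_bigr => l _; rewrite [col _ _ _ _]mxE.
    by rewrite [C1 _ _]mxE.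
  rewrite /rho HE mulmxA mulmxK // -mulmxA.
  apply: (canLR (mulKmx Cu)); apply/colP => i.
  rewrite CE ?mulgA; last exact: GM.
  rewrite he //; last exact: GM.
  by rewrite !mxE; apply: eq_bigr => l _; rewrite [C1 _ _]mxE.
have rhoE (A B : 'M[L]_n) : (forall j, A *m e (y j) = B *m e (y j)) -> A = B.
  move=> AB; apply: (can_inj (mulmxK Eu)); apply/matrixP => i j.
  have /colP /(_ i) := AB j; rewrite -colE mxE [RHS]mxE => ABij; rewrite mxE [RHS]mxE.
  transitivity (\sum_l A i l * (col j E) l ord0).
    by apply: eq_bigr => l _; rewrite [col _ _ _ _]mxE.
  by rewrite ABij; apply: eq_bigr => l _; rewrite [col _ _ _ _]mxE.
exists n, rho, (c 1%g), (e 1%g); split.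
- by apply: rhoE => j; rewrite rhoe // mul1g mul1mx.
- move=> a b Ga Gb; apply: rhoE => j.
  rewrite -mulmxA !rhoe ?mulgA //; first exact: GM.
  by apply: GM.
- by move=> g Gg; rewrite -mulmxA rhoe // -he ?mulg1 ?mul1g.
- by exists (invmx C), (invmx E), x, y.
Qed.

End FiniteRank.

(** * Uniform bound on the degree *)

Section BoundedDegree.
Variables (k : closedFieldType) (N : nat) (X : set 'rV[k]_N).
Local Notation Aut := (aut X).
Variables (V : set Aut) (d : nat).
Hypotheses (Vcomm : commutative_subset V) (Virr : regfun_irreducible V).
Hypotheses (V1 : V 1%g) (Vd : V `<=` aut_le d).
Local Notation Gamma := (subgroup_generated V).

(** By irreducibility, the nonempty sets of points of [Y] where some polynomial does not vanish are
    stable under intersection, and any ultrafilter containing them works. The restriction of a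
    polynomial to [Y] is then determined by its class in the ultrapower. *)
Lemma generic_ultrafilter (Y : set 'rV[k]_N) : Y `<=` X -> irreducible_points Y ->
  exists2 U : set_system X, UltraFilter U &
    forall p, U [set y : X | p.@[val y ord0] = 0] -> vanish Y p.
Proof.
move=> YX [[y0 Yy0] Yprime].
pose D p : set X := [set y : X | Y (val y) /\ p.@[val y ord0] != 0].
pose F : set_system X := [set A | exists2 p, ~ vanish Y p & D p `<=` A].
have D0 p : ~ vanish Y p -> D p !=set0.
  move=> /existsNP [y /not_implyP [Yy /eqP py]].
  by exists (exist _ y (mem_set (YX _ Yy))).
have PF : ProperFilter F.
  split; first by move=> [p /D0 [y Dy] /(_ y Dy)].
  split.
  - exists 1 => // /(_ y0 Yy0) /eqP; by rewrite meval1 oner_eq0.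
  - move=> A B [p pY pA] [q qY qB]; exists (p * q).
      by move=> /Yprime [].
    move=> y [Yy]; rewrite mevalM mulf_eq0 negb_or => /andP[py qy].
    by split; [apply: pA|apply: qB].
  - by move=> A B AB [p pY pA]; exists p => // y /pA /AB.
have [U [UU FU]] := ultraFilterLemma PF.
exists U => // p Up; apply: contrapT => npY.
have : U (D p) by apply: FU; exists p.
move=> /(filterI Up) H; apply: (filter_not_empty U).
by apply: filterS H => y [py [_ /eqP]]; apply.
Qed.

Definition finite_span_on (Y : set 'rV[k]_N) (i : 'I_N) : Prop :=
  exists (q : nat) (g : 'I_q -> Aut), (forall j, Gamma (g j)) /\
    forall gamma, Gamma gamma -> exists b : 'rV[k]_q,
      forall y : X, Y (val y) ->
        val (gamma y) ord0 i = \sum_j b ord0 j * val (g j y) ord0 i.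

(** [R] attaches to each [gamma] a coordinate vector in a fixed space, in such a way that linear
    relations between vectors give relations between functions. Elements of [Gamma] whose vectors
    form a basis then span. *)
Lemma finite_span_coordinates (Y : set 'rV[k]_N) (i : 'I_N) (m : nat)
    (R : Aut -> 'rV[k]_m -> Prop) :
  (forall gamma, Gamma gamma -> exists a, R gamma a) ->
  (forall (q : nat) (g : 'I_q -> Aut) gamma (b : 'rV[k]_q) (c : 'I_q -> 'rV[k]_m),
    Gamma gamma -> (forall j, Gamma (g j)) -> (forall j, R (g j) (c j)) ->
    R gamma (\sum_j b ord0 j *: c j) ->
    forall y : X, Y (val y) ->
        val (gamma y) ord0 i = \sum_j b ord0 j * val (g j y) ord0 i) ->
  finite_span_on Y i.
Proof.
move=> exR RP.
have /choice [a aR] : forall gamma, exists a, Gamma gamma -> R gamma a.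
  move=> gamma; have [/exR [a ?]|] := pselect (Gamma gamma); first by exists a.
  by exists 0.
have [q [g [Gg _ Bsub]]] := exists_row_basis Gamma a.
exists q, g; split=> // gamma Ggamma.
have [b bE] := submxP (Bsub _ Ggamma).
exists b; apply: (RP q g gamma b (a \o g)) => // [j|]; first exact: aR.
rewrite (_ : \sum_j _ = a gamma); first exact: aR.
by rewrite bE mulmx_sum_row; apply: eq_bigr => j _; rewrite rowK.
Qed.

Lemma irreducible_finite_span (Y : set 'rV[k]_N) (i : 'I_N) :
  Y `<=` X -> irreducible_points Y -> finite_span_on Y i.
Proof.
move=> YX Yirr; have [U UU UY] := generic_ultrafilter YX Yirr.
have Gcomm := subgroup_generated_commutative Vcomm.
have [G1 GM GI] := subgroup_generated_subgroup V.
have GV := @sub_subgroup_generated _ V.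
pose cl (f : X -> k) : ultrapower k UU := ultra_class UU f.
pose iota : {rmorphism k -> ultrapower k UU} := ultra_const UU.
pose h (g : Aut) := cl (fun y => val (g y) ord0 i).
have [r [t tP]] := orbit_rank Vcomm Virr V1 Vd i.
(* The coefficients are picked at each point [y] without any regularity; they become elements of the
   ultrapower. *)
have /choice [c cP] : forall gamma, exists c : X -> 'I_r -> k,
    Gamma gamma -> forall y g, Gamma g ->
      val (gamma (g y)) ord0 i = \sum_l (t l).@[val (g y) ord0] * c y l.
  move=> gamma; have [Gg|] := pselect (Gamma gamma); last by exists (fun=> fun=> 0).
  have /choice [c cP] : forall y, exists c : 'I_r -> k, forall g, Gamma g ->
      val (gamma (g y)) ord0 i = \sum_l (t l).@[val (g y) ord0] * c l.
    by move=> y; exact: tP.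
  by exists c.
have [|n [rho [p [q [rho1 rhoM hrho [C [E [x [y [Gx Gy rhoE]]]]]]]]]] :=
  @finite_rank_representation (ultrapower k UU) _ V h r
    (fun g => \row_l cl (fun y => (t l).@[val (g y) ord0]))
    (fun gamma => \col_l cl (fun y => c gamma y l)).
  (* Commutativity puts [b] outside, where the expansion of [b (a y)] on the orbit of [y]
     applies. *)
  move=> a b Ga Gb; rewrite Gcomm // mxE.
  rewrite /h (_ : (fun y => _) = fun y => \sum_l (t l).@[val (a y) ord0] * c b y l).
    rewrite /cl ultra_class_sum; apply: eq_bigr => l _.
    by rewrite !mxE -ultra_classM.
  by apply/funext => y; exact: cP.
(* [w] will be the identity and then inversion. An entry of [rho (w v)] is a combination of values
   [h (s * w v)], and interpolation at the points [z l] separates the dependence on [v] from the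
   functions on [X]. *)
have fam (w : Aut -> Aut) (e : nat) :
    (forall v, V v -> Gamma (w v)) -> (forall v, V v -> aut_le e (w v)) ->
    (forall (s : Aut) (z : X) j, regfun (fun v => val (s (w v z)) ord0 j)) ->
    forall a b, algebraic_family iota V (@regfun _ _ X) (fun v => rho (w v) a b).
  move=> wG we wreg a b.
  apply: (@eq_family _ _ _ _ _ _ (fun v =>
      (C *m (\matrix_(i, j) h (x i * w v * y j)%g) *m E) a b)).
    by move=> v Vv; rewrite rhoE //; exact: wG.
  apply: family_mulmx => {}a {}b.
  set s := (x a * y b)%g.
  have Gs : Gamma s by apply: GM.
  have [e' se'] := aut_le_exists s.
  have [r' [z [t' [_ _ t'P]]]] := interpolation_aut X (e' * e).
  apply: (@eq_family _ _ _ _ _ _ (fun v => \sum_l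
      iota (val (s (w v (z l))) ord0 i) * cl (fun y => (t' l).@[val y ord0]))).
    move=> v Vv; rewrite mxE -mulgA (Gcomm (w v)) ?mulgA //; last exact: wG.
    rewrite -/s /h /iota /=.
    under eq_bigr do rewrite -ultra_classM.
    rewrite -ultra_class_sum; congr (ultra_class _ _); apply/funext => y'.
    by rewrite (t'P (s * w v)%g) //; apply: aut_le_mul => //; exact: we.
  by apply: family_sum => l; apply: family_mono; exact: wreg.
have [sp spP] : kfinite iota [set x | exists g a b, Gamma g /\ x = rho g a b].
  apply: (@representation_kfinite _ _ iota _ V (@regfun _ _ X)) => //.
  - exact: regfun_comb.
  - by case: Virr.
  - apply: (fam id d) => //; exact: regfun_comp_eval.
  - apply: (fam (fun v => v^-1)%g d).
    + by move=> v Vv; apply: GI; exact: GV.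
    + by move=> v Vv; apply: aut_le_inv; exact: Vd.
    + exact: regfun_comp_evalV.
pose s := [seq a * b | a <- sp, b <- [seq p ord0 ab.1 * q ab.2 ord0 |
  ab <- enum {: 'I_n * 'I_n}]].
have hs g : Gamma g -> kspan iota s (h g).
  move=> Gg; rewrite hrho // mxE; apply: kspan_sum => b.
  rewrite mxE mulr_suml; apply: kspan_sum => a.
  rewrite (_ : _ * _ * _ = rho g a b * (p ord0 a * q b ord0)); last by ring.
  apply: kspanM; first by apply: spP; exists g, a, b.
  apply: kspan_mem; apply/mapP; exists (a, b) => //; exact: mem_enum.
apply: (@finite_span_coordinates _ _ (size s) (fun gamma a =>
  h gamma = \sum_j iota (a ord0 j) * s`_j)).
  by move=> gamma /hs /kspan_coef.
move=> q' g gamma b a Ggamma Gg gE gammaE z Yz.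
have [P Pgamma] := aut_fun_regular gamma.
have /choice [Q QP] : forall j, exists Q, represents Q (g j).
  by move=> j; exact: aut_fun_regular.
apply/eqP; rewrite -subr_eq0; apply/eqP.
(* Equality in the ultrapower means equality almost everywhere, hence on all of [Y] by the choice of
   [U]. *)
have : vanish Y (P i - \sum_j b ord0 j *: Q j i).
  apply: UY.
  have : h gamma = \sum_j iota (b ord0 j) * h (g j).
    rewrite gammaE; under [RHS]eq_bigr do rewrite gE mulr_sumr.
    rewrite exchange_big /=; apply: eq_bigr => l _.
    rewrite summxE rmorph_sum mulr_suml; apply: eq_bigr => j _.
    by rewrite mxE rmorphM mulrA.
  rewrite /h /iota /=; under eq_bigr do rewrite -ultra_classM.
  rewrite -ultra_class_sum => /ultra_classP; apply: filterS => y' /= e.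
  rewrite mevalB -Pgamma e; apply/eqP; rewrite subr_eq0 raddf_sum; apply/eqP.
  by apply: eq_bigr => j _ /=; rewrite mevalZ QP.
move=> /(_ _ Yz); rewrite mevalB -Pgamma => e; rewrite -[RHS]e.
by congr (_ - _); rewrite raddf_sum; apply: eq_bigr => j _ /=; rewrite mevalZ QP.
Qed.

Lemma closed_finite_span (Y : set 'rV[k]_N) (i : 'I_N) :
  zariski_closed Y -> Y `<=` X -> finite_span_on Y i.
Proof.
move: Y; apply: closed_ind => Y Yc IH YX.
have [Y0|Y0] := pselect (Y !=set0); last first.
  exists 0, (fun=> 1%g); split=> [[]//|gamma _]; exists 0 => y Yy.
  by exfalso; apply: Y0; exists (val y).
have [|nirr] := pselect (irreducible_points Y); first exact: irreducible_finite_span.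
have [p [q [pq np nq]]] : exists p q,
    [/\ vanish Y (p * q), ~ vanish Y p & ~ vanish Y q].
  apply: contrapT => H; apply: nirr; split=> // p q pq.
  have [|np] := pselect (vanish Y p); first by left.
  have [|nq] := pselect (vanish Y q); first by right.
  by exfalso; apply: H; exists p, q.
pose Z (p : {mpoly k[N]}) := Y `&` [set x : 'rV[k]_N | p.@[x ord0] = 0].
have ZP p' : ~ vanish Y p' -> finite_span_on (Z p') i.
  move=> np'; apply: IH; first exact: zariski_closedI_zero.
  - by move=> x [].
  - by move=> YZ; apply: np' => x /YZ [].
  - by move=> x [/YX].
have [m1 [g1 [Gg1 span1]]] := ZP _ np.
have [m2 [g2 [Gg2 span2]]] := ZP _ nq.
(* Coordinates on the two pieces are concatenated, so that a single relation holds on both. *)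
apply: (@finite_span_coordinates _ _ (m1 + m2) (fun gamma a =>
  (forall y : X, Z p (val y) -> val (gamma y) ord0 i =
     \sum_j (lsubmx a) ord0 j * val (g1 j y) ord0 i) /\
  (forall y : X, Z q (val y) -> val (gamma y) ord0 i =
     \sum_j (rsubmx a) ord0 j * val (g2 j y) ord0 i))).
  move=> gamma Gg; have [b1 b1P] := span1 _ Gg; have [b2 b2P] := span2 _ Gg.
  by exists (row_mx b1 b2); rewrite row_mxKl row_mxKr.
move=> r g gamma b c Ggamma Gg gE [gammaE1 gammaE2] y Yy.
have /eqP := pq _ Yy; rewrite mevalM mulf_eq0 => /orP[/eqP py|/eqP qy].
  have Zy : Z p (val y) by split.
  rewrite gammaE1 //; under [RHS]eq_bigr do rewrite ((gE _).1 y Zy) mulr_sumr.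
  rewrite exchange_big /=; apply: eq_bigr => l _.
  rewrite mxE summxE mulr_suml; apply: eq_bigr => j _.
  by rewrite !mxE mulrA.
have Zy : Z q (val y) by split.
rewrite gammaE2 //; under [RHS]eq_bigr do rewrite ((gE _).2 y Zy) mulr_sumr.
rewrite exchange_big /=; apply: eq_bigr => l _.
rewrite mxE summxE mulr_suml; apply: eq_bigr => j _.
by rewrite !mxE mulrA.
Qed.

Hypothesis Xc : zariski_closed X.

Lemma subgroup_generated_aut_le : exists D, Gamma `<=` aut_le D.
Proof.
have [G1 GM GI] := subgroup_generated_subgroup V.
have H i : exists D, forall gamma, Gamma gamma -> exists2 p : {mpoly k[N]},
    (msize p <= D.+1)%N & forall y : X, val (gamma y) ord0 i = p.@[val y ord0].
  have [q [g [Gg span]]] := closed_finite_span i Xc (@subset_refl _ X).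
  have /choice [P PP] : forall j, exists P, represents P (g j).
    by move=> j; exact: aut_fun_regular.
  exists (\max_j msize (P j i)) => gamma /span [b bP].
  exists (\sum_j b ord0 j *: P j i) => [|y].
    apply: leqW; apply: leq_trans (msize_sum _ _ _) _.
    apply/bigmax_leqP => j _; apply: leq_trans (msizeZ_le _ _) _.
    exact: (leq_bigmax (F := fun j => msize (P j i))).
  rewrite bP; last exact: set_valP.
  by rewrite raddf_sum; apply: eq_bigr => j _ /=; rewrite mevalZ PP.
have /choice [D DP] := H.
have {}H gamma : Gamma gamma -> degree_le (\max_i D i) gamma.
  move=> Gg; have /choice [P PP] : forall i, exists p : {mpoly k[N]},
      (msize p <= (D i).+1)%N /\ forall y : X, val (gamma y) ord0 i = p.@[val y ord0].
    by move=> i; have [p] := DP i _ Gg; exists p.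
  exists P => [i|y i]; last by have [] := PP i.
  have [Pi _] := PP i; apply: leq_trans Pi _; rewrite ltnS; exact: leq_bigmax.
by exists (\max_i D i) => gamma Gg; split; apply: H => //; exact: GI.
Qed.

End BoundedDegree.

(** * Constructible sets *)

Section Chevalley.
Variable k : closedFieldType.

Definition env (n : nat) (x : 'rV[k]_n) : seq k := [seq x ord0 i | i <- enum 'I_n].

Lemma nth_env (n : nat) (x : 'rV[k]_n) (i : 'I_n) : (env x)`_i = x ord0 i.
Proof.
by rewrite /env (nth_map i) ?size_enum_ord // nth_ord_enum.
Qed.

Lemma rterm_mpoly (n : nat) (t : GRing.term k) : GRing.rterm t ->
  exists P : {mpoly k[n]}, forall x, GRing.eval (env x) t = P.@[x ord0].
Proof.
elim: t => //=.
- move=> i _; have [ni|ni] := ltnP i n.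
    by exists 'X_(Ordinal ni) => x; rewrite mevalXU -nth_env.
  by exists 0 => x; rewrite meval0 nth_default // size_map size_enum_ord.
- by move=> c _; exists c%:MP => x; rewrite mevalC.
- by move=> c _; exists c%:R%:MP => x; rewrite mevalC.
- move=> t1 IH1 t2 IH2 /andP[/IH1 [P PE] /IH2 [Q QE]].
  by exists (P + Q) => x; rewrite mevalD PE QE.
- by move=> t IH /IH [P PE]; exists (- P) => x; rewrite mevalN PE.
- by move=> t IH j /IH [P PE]; exists (P *+ j) => x; rewrite mevalMn PE.
- move=> t1 IH1 t2 IH2 /andP[/IH1 [P PE] /IH2 [Q QE]].
  by exists (P * Q) => x; rewrite mevalM PE QE.
- by move=> t IH j /IH [P PE]; exists (P ^+ j) => x; rewrite rmorphXn /= PE.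
Qed.

(** The shift [j] leaves the first positions to the free variables; in [chevalley] the parameters
    start at position [M]. *)
Lemma mpoly_rterm (n j : nat) (p : {mpoly k[n]}) : exists t : GRing.term k,
  GRing.rterm t /\ forall e, GRing.eval e t = p.@[fun i => e`_(j + i)].
Proof.
elim/mpolyind: p => [|c m p _ _ [t [rt tE]]].
  by exists (GRing.Const 0); split=> // e; rewrite meval0.
have [tm [rtm tmE]] : exists tm : GRing.term k, GRing.rterm tm /\
    forall e, GRing.eval e tm = \prod_(i < n) e`_(j + i) ^+ m i.
  elim: (index_enum _) => [|i s [t' [rt' t'E]]].
    by exists (GRing.Const 1); split=> // e; rewrite big_nil.
  exists (GRing.Mul (GRing.Exp (GRing.Var k (j + i)) (m i)) t'); split=> // e.
  by rewrite big_cons /= t'E.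
exists (GRing.Add (GRing.Mul (GRing.Const c) tm) t); split; first by rewrite /= rtm.
by move=> e; rewrite /= tmE tE mevalD mevalZ mevalX.
Qed.

Definition closure_points (n : nat) (S : set 'rV[k]_n) : set 'rV[k]_n :=
  [set x | forall q, vanish S q -> q.@[x ord0] = 0].

(** Openness is relative to the closure of [S] rather than to [S]; this is what later reaches
    elements of the closure of the group. *)
Definition generically (n : nat) (S T : set 'rV[k]_n) : Prop :=
  exists2 p, ~ vanish S p &
    forall x, closure_points S x -> p.@[x ord0] <> 0 -> T x.

Lemma generically_sub (n : nat) (S T T' : set 'rV[k]_n) :
  T `<=` T' -> generically S T -> generically S T'.
Proof. by move=> TT' [p np pT]; exists p => // x xS px; apply/TT'/pT. Qed.

Lemma generically_and (n : nat) (S T T' : set 'rV[k]_n) : irreducible_points S ->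
  generically S T -> generically S T' -> generically S (T `&` T').
Proof.
move=> [_ Sprime] [p np pT] [q nq qT]; exists (p * q).
  by move=> /Sprime [].
move=> x xS; rewrite mevalM => /eqP; rewrite mulf_eq0 negb_or => /andP[/eqP px /eqP qx].
by split; [apply: pT|apply: qT].
Qed.

(** An atom compares two polynomials, whose difference either vanishes on all of [S] or is nonzero
    on an open set; irreducibility lets the open sets of subformulas be intersected. *)
Lemma qf_generic (n : nat) (S : set 'rV[k]_n) (f : GRing.formula k) :
  irreducible_points S -> GRing.qf_form f && GRing.rformula f ->
  generically S [set x | GRing.qf_eval (env x) f] \/
  generically S [set x | ~~ GRing.qf_eval (env x) f].
Proof.
move=> Sirr; have [[x0 Sx0] _] := Sirr.
have triv (T : set 'rV[k]_n) : (forall x, closure_points S x -> T x) -> generically S T.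
  move=> ST; exists 1; first by move=> /(_ x0 Sx0) /eqP; rewrite meval1 oner_eq0.
  by move=> x /ST.
elim: f => //=.
- move=> [] _; [left|right]; exact: triv.
- move=> t1 t2 /andP[/(rterm_mpoly n) [P PE] /(rterm_mpoly n) [Q QE]].
  have [v|nv] := pselect (vanish S (P - Q)).
    left; apply: triv => x /(_ _ v) /eqP.
    by rewrite mevalB subr_eq0 /= PE QE.
  right; exists (P - Q) => // x _ /eqP; rewrite mevalB subr_eq0 /= PE QE.
  by [].
- move=> f1 IH1 f2 IH2; rewrite andbACA => /andP[/IH1 H1 /IH2 H2].
  case: H1 => [H1|H1]; last first.
    by right; apply: generically_sub H1 => x /= /negPf ->.
  case: H2 => [H2|H2]; last first.
    by right; apply: generically_sub H2 => x /= /negPf ->; rewrite andbF.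
  by left; apply: generically_sub (generically_and Sirr H1 H2) => x /= [-> ->].
- move=> f1 IH1 f2 IH2; rewrite andbACA => /andP[/IH1 H1 /IH2 H2].
  case: H1 => [H1|H1].
    by left; apply: generically_sub H1 => x /= ->.
  case: H2 => [H2|H2].
    by left; apply: generically_sub H2 => x /= ->; rewrite orbT.
  right; apply: generically_sub (generically_and Sirr H1 H2) => x /= [].
  by move=> /negPf -> /negPf ->.
- move=> f1 IH1 f2 IH2; rewrite andbACA => /andP[/IH1 H1 /IH2 H2].
  case: H1 => [H1|H1]; last first.
    by left; apply: generically_sub H1 => x /= /negPf ->.
  case: H2 => [H2|H2].
    by left; apply: generically_sub H2 => x /= ->; rewrite implybT.
  by right; apply: generically_sub (generically_and Sirr H1 H2) => x /= [-> /negPf ->].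
- move=> f IH /IH [H|H]; [right|left]; last exact: H.
  by apply: generically_sub H => x /= ->.
Qed.

(** A weak form of Chevalley's theorem on images. The set [T] is defined by an existential formula
    over the parameters, and quantifier elimination over [k] makes [qf_generic] applicable. *)
Lemma chevalley (M s : nat) (S : set 'rV[k]_M) (I : set {mpoly k[s]})
    (F : 'I_M -> {mpoly k[s]}) (T : set 'rV[k]_M) :
  irreducible_points S ->
  (forall y, T y <-> exists2 c, zero_locus I c &
    forall l, y ord0 l = (F l).@[c ord0]) ->
  generically S T \/ generically S (~` T).
Proof.
move=> Sirr TE.
have [gs gI Igs] := zero_locus_finite I.
have /choice [tm tmP] : forall p : {mpoly k[s]}, exists t : GRing.term k,
    GRing.rterm t /\ forall e, GRing.eval e t = p.@[fun i => e`_(M + i)].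
  by move=> p; exact: mpoly_rterm.
pose fs := [seq GRing.Equal (tm p) (GRing.Const 0) | p <- gs] ++
  [seq GRing.Equal (GRing.Var k (val l)) (tm (F l)) | l <- enum 'I_M].
pose body := foldr GRing.And (GRing.Bool true) fs.
have rbody : GRing.rformula body.
  rewrite /body /fs foldr_cat; elim: gs {gI Igs fs body} => [|p gs IH] /=.
    elim: (enum _) => //= l ls ->; by rewrite (tmP _).1.
  by rewrite (tmP _).1.
have bodyP e : GRing.holds e body <->
    (forall p, p \in gs -> p.@[fun i => e`_(M + i)] = 0) /\
    (forall l : 'I_M, e`_l = (F l).@[fun i => e`_(M + i)]).
  rewrite /body /fs foldr_cat; elim: gs {gI Igs fs body rbody} => [|p gs IH] /=.
    suff H ls : GRing.holds e (foldr GRing.And (GRing.Bool true)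
        [seq GRing.Equal (GRing.Var k (val l)) (tm (F l)) | l <- ls]) <->
        forall l : 'I_M, l \in ls -> e`_l = (F l).@[fun i => e`_(M + i)].
      rewrite H; split=> [h|[_ h] l _]; last exact: h.
      by split=> // l; apply: h; rewrite mem_enum.
    elim: ls => [|l ls IH] //=; rewrite IH (tmP _).2; split.
      by move=> [el els] l'; rewrite inE => /predU1P[->|/els].
    by move=> h; split=> [|l' l'ls]; apply: h; rewrite inE ?eqxx ?l'ls ?orbT.
  rewrite IH (tmP _).2; split.
    by move=> [ep [egs eF]]; split=> // q; rewrite inE => /predU1P[->|/egs].
  move=> [h eF]; split; first by apply: h; rewrite mem_head.
  by split=> // q qgs; apply: h; rewrite inE qgs orbT.
pose f := foldr GRing.Exists body (iota M s).
have rf : GRing.rformula f.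
  by rewrite /f; elim: (iota M s).
have TP y : T y <-> GRing.holds (env y) f.
  rewrite -GRing.foldExistsP TE; split.
    move=> [c /= Ic yE]; exists (env y ++ env c).
      move=> i; rewrite inE mem_iota negb_and -ltnNge -leqNgt => iM.
      rewrite nth_cat size_map size_enum_ord; case: ltnP => // Mi.
      rewrite ltnNge Mi /= in iM.
      rewrite !nth_default ?size_map -?enumT ?size_enum_ord //.
      by rewrite leq_subRL.
    have eE : (fun i : 'I_s => (env y ++ env c)`_(M + i)) =1 c ord0.
      move=> i; rewrite nth_cat size_map size_enum_ord ltnNge leq_addr /=.
      by rewrite addKn nth_env.
    apply/bodyP; split=> [p /gI Ip|l]; first by rewrite (meval_eq _ eE) Ic.
    by rewrite (meval_eq _ eE) -yE nth_cat size_map size_enum_ord ltn_ord nth_env.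
  move=> [e ye /bodyP [egs eF]].
  exists (\row_i e`_(M + i)).
    apply: Igs => p /egs; apply: etrans; apply: meval_eq => i.
    by rewrite mxE.
  move=> l; rewrite -nth_env ye; last first.
    by rewrite inE mem_iota leqNgt ltn_ord.
  by rewrite eF; apply: meval_eq => i; rewrite mxE.
have proj_ok := ClosedFieldQE.holds_ex_elim (@solve_monicpoly k).
have proj_wf := @ClosedFieldQE.wf_ex_elim k.
have qfP := GRing.quantifier_elim_rformP proj_wf proj_ok.
have qfwf := GRing.quantifier_elim_wf proj_wf rf.
case: (qf_generic Sirr qfwf) => H; [left|right]; apply: generically_sub H => y /=.
  by move=> /(qfP _ _ rf) /TP.
by move=> /negP ny /TP ?; apply: ny; apply/(qfP _ _ rf).
Qed.

End Chevalley.

(** * Closedness of the generated group *)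

Section Parametrization.
Variables (k : fieldType) (N : nat) (X : set 'rV[k]_N).
Local Notation Aut := (aut X).

Definition acts_by (s : nat) (C : set 'rV[k]_s) (u : 'rV[k]_s -> Aut)
    (U : 'I_N -> {mpoly k[s + N]}) : Prop :=
  forall c, C c -> forall (x : X) i,
    val (u c x) ord0 i = (U i).@[row_mx c (val x) ord0].

(** The action is polynomial jointly in the parameter and the point, so compositions and values at
    fixed points stay polynomial in the parameter. Inverses are recorded too, because letters
    contain them. *)
Definition parametrized (S : set Aut) : Prop :=
  exists (s : nat) (I : set {mpoly k[s]}) (u : 'rV[k]_s -> Aut)
    (U U' : 'I_N -> {mpoly k[s + N]}),
    [/\ S = u @` zero_locus I, acts_by (zero_locus I) u U
      & acts_by (zero_locus I) (fun c => (u c)^-1)%g U'].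

Lemma mpoly_subst (s s1 s2 : nat) (f1 : 'I_s1 -> 'I_s) (f2 : 'I_s2 -> 'I_s)
    (U1 : 'I_N -> {mpoly k[s1 + N]}) (U2 : 'I_N -> {mpoly k[s2 + N]}) :
  exists W : 'I_N -> {mpoly k[s + N]}, forall (c : 'rV[k]_s) (z : 'rV[k]_N) i,
    (W i).@[row_mx c z ord0] =
    (U1 i).@[row_mx (\row_l c ord0 (f1 l))
      (\row_j (U2 j).@[row_mx (\row_l c ord0 (f2 l)) z ord0]) ord0].
Proof.
pose V2 j : {mpoly k[s + N]} := U2 j \mPo [tuple
  match split l with inl a => 'X_(lshift N (f2 a)) | inr b => 'X_(rshift s b) end
  | l < s2 + N].
have V2E (c : 'rV[k]_s) (z : 'rV[k]_N) j : (V2 j).@[row_mx c z ord0] =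
    (U2 j).@[row_mx (\row_l c ord0 (f2 l)) z ord0].
  rewrite comp_mpoly_meval; apply: meval_eq => l.
  rewrite tnth_map tnth_ord_tuple; case: splitP => a la.
    rewrite mevalXU row_mxEl (_ : l = lshift N a); last exact: val_inj.
    by rewrite row_mxEl mxE.
  rewrite mevalXU row_mxEr (_ : l = rshift s2 a); last exact: val_inj.
  by rewrite row_mxEr.
exists (fun i => U1 i \mPo [tuple
  match split l with inl a => 'X_(lshift N (f1 a)) | inr b => V2 b end
  | l < s1 + N]) => c z i.
rewrite comp_mpoly_meval; apply: meval_eq => l.
rewrite tnth_map tnth_ord_tuple; case: splitP => a la.
  rewrite mevalXU row_mxEl (_ : l = lshift N a); last exact: val_inj.
  by rewrite row_mxEl mxE.
rewrite V2E (_ : l = rshift s1 a); last exact: val_inj.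
by rewrite row_mxEr mxE.
Qed.

Lemma parametrized1 : parametrized [set 1%g].
Proof.
exists 0, set0, (fun=> 1%g), (fun i => 'X_(rshift 0 i)), (fun i => 'X_(rshift 0 i)).
split.
- apply/seteqP; split=> [_ ->|_ [c _ <-] //]; by exists 0.
- by move=> c _ x i; rewrite mevalXU row_mxEr.
- by move=> c _ x i; rewrite invg1 mevalXU row_mxEr.
Qed.

Lemma parametrized_inv (S : set Aut) :
  parametrized S -> parametrized [set (f^-1)%g | f in S].
Proof.
move=> [s [I [u [U [U' [SE uU uU']]]]]].
exists s, I, (fun c => (u c)^-1)%g, U', U; split=> //.
rewrite SE; apply/seteqP; split=> [_ [_ [c Ic <-] <-]|_ [c Ic <-]].
  by exists c.
by exists (u c) => //; exists c.
Qed.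

Lemma acts_by_comp (s s1 s2 : nat) (C1 : set 'rV[k]_s1) (C2 : set 'rV[k]_s2)
    (f1 : 'I_s1 -> 'I_s) (f2 : 'I_s2 -> 'I_s)
    (u1 : 'rV[k]_s1 -> Aut) (u2 : 'rV[k]_s2 -> Aut)
    (U1 : 'I_N -> {mpoly k[s1 + N]}) (U2 : 'I_N -> {mpoly k[s2 + N]}) :
  acts_by C1 u1 U1 -> acts_by C2 u2 U2 ->
  exists W, acts_by
    [set c | C1 (\row_l c ord0 (f1 l)) /\ C2 (\row_l c ord0 (f2 l))]
    (fun c => (u1 (\row_l c ord0 (f1 l)) * u2 (\row_l c ord0 (f2 l)))%g) W.
Proof.
move=> uU1 uU2; have [W WE] := mpoly_subst f1 f2 U1 U2; exists W.
move=> c [C1c C2c] x i; rewrite WE uU1 //; apply: meval_eq => l.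
congr (row_mx _ _ _ _); apply/rowP => j.
by rewrite [RHS]mxE uU2.
Qed.

Lemma parametrized_mul (S1 S2 : set Aut) : parametrized S1 -> parametrized S2 ->
  parametrized [set g | exists f h, [/\ S1 f, S2 h & g = (f * h)%g]].
Proof.
move=> [s1 [I1 [u1 [U1 [U1' [-> uU1 uU1']]]]]] [s2 [I2 [u2 [U2 [U2' [-> uU2 uU2']]]]]].
pose s := (s1 + s2)%N.
pose f1 : 'I_s1 -> 'I_s := @lshift s1 s2.
pose f2 : 'I_s2 -> 'I_s := @rshift s1 s2.
pose u (c : 'rV[k]_s) := (u1 (\row_l c ord0 (f1 l)) * u2 (\row_l c ord0 (f2 l)))%g.
pose I : set {mpoly k[s]} :=
  [set p \mPo [tuple 'X_(f1 l) | l < s1] | p in I1] `|`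
  [set p \mPo [tuple 'X_(f2 l) | l < s2] | p in I2].
have IE : zero_locus I = [set c | zero_locus I1 (\row_l c ord0 (f1 l)) /\
    zero_locus I2 (\row_l c ord0 (f2 l))].
  have E n (f : 'I_n -> 'I_s) p (c : 'rV[k]_s) :
      (p \mPo [tuple 'X_(f l) | l < n]).@[c ord0] = p.@[(\row_l c ord0 (f l)) ord0].
    rewrite comp_mpoly_meval; apply: meval_eq => l.
    by rewrite tnth_map tnth_ord_tuple mevalXU mxE.
  apply/seteqP; split=> [c Ic|c [Ic1 Ic2] _ [[p Ip <-]|[p Ip <-]]].
  - by split=> p Ip; rewrite -E; apply: Ic; [left|right]; exists p.
  - by rewrite E Ic1.
  - by rewrite E Ic2.
have [W uW] := acts_by_comp f1 f2 uU1 uU2.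
have [W' uW'] := acts_by_comp f2 f1 uU2' uU1'.
exists s, I, u, W, W'; rewrite IE; split=> //; last first.
  move=> c [Ic1 Ic2] x i; rewrite /u invgM; exact: (uW' c (conj Ic2 Ic1)).
apply/seteqP; split=> [_ [_ [_ [[c1 Ic1 <-] [c2 Ic2 <-] ->]]]|_ [c [Ic1 Ic2] <-]].
  have e1 : \row_l row_mx c1 c2 ord0 (f1 l) = c1.
    by apply/rowP => l; rewrite mxE row_mxEl.
  have e2 : \row_l row_mx c1 c2 ord0 (f2 l) = c2.
    by apply/rowP => l; rewrite mxE row_mxEr.
  by exists (row_mx c1 c2); rewrite /u /= e1 e2.
by exists (u1 (\row_l c ord0 (f1 l))), (u2 (\row_l c ord0 (f2 l))).
Qed.

Lemma parametrized_word (V : set Aut) n :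
  parametrized V -> parametrized (word V n).
Proof.
move=> Vp; elim: n => [|n IH]; first exact: parametrized1.
have := parametrized_mul Vp (parametrized_mul (parametrized_inv Vp) IH).
congr parametrized; apply/seteqP; split=> g /=.
  move=> [v [_ [Vv [_ [h [[w Vw <-] wh ->]]] ->]]].
  by exists v, w, h; rewrite mulgA.
move=> [v [w [h [Vv Vw wh ->]]]]; exists v, (w^-1 * h)%g; rewrite mulgA.
by split=> //; exists (w^-1)%g, h; split=> //; exists w.
Qed.

Hypothesis Xc : zariski_closed X.

(* The coordinates of the pairs [(f, f^-1)] form a closed set: it is cut out by
   the equations expressing that [A] and [B] define inverse selfmaps of [X]. *)
Lemma parametrized_closed (S : set Aut) d :
  closed_in_aut_le d S -> S `<=` aut_le d -> parametrized S.
Proof.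
move=> [m [e [[eP efree espan] [Z [J ZE] SZ]]]] Sd.
have /choice [E EP] : forall j, exists p : {mpoly k[N]},
    (msize p <= d.+1)%N /\ forall x : X, e j x = p.@[val x ord0].
  by move=> j; have [p] := eP j; exists p.
pose s := ((N + N) * m)%N.
pose A (c : 'rV[k]_s) : 'M[k]_(N, m) := usubmx (vec_mx c).
pose B (c : 'rV[k]_s) : 'M[k]_(N, m) := dsubmx (vec_mx c).
have cAB c : mxvec (col_mx (A c) (B c)) = c by rewrite vsubmxK vec_mxK.
have AE c i j : A c i j = c ord0 (mxvec_index (lshift N i) j).
  by rewrite -[in RHS](cAB c) mxvecE col_mxEu.
have BE c i j : B c i j = c ord0 (mxvec_index (rshift N i) j).
  by rewrite -[in RHS](cAB c) mxvecE col_mxEd.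
pose C : set 'rV[k]_s := [set c | exists v, [/\ S v, coordinates e v (A c)
  & coordinates e (v^-1)%g (B c)]].
(* All polynomials vanishing on [C] are taken as equations. Every property defining [C] is
   polynomial in [c] (image in [X], mutual inversion, membership in [Z]), so it passes from [C] to
   its closure, and [C] turns out to be closed. *)
pose I := vanish C.
pose ap (M : 'M[k]_(N, m)) (x : X) : 'rV[k]_N := \row_i \sum_j M i j * e j x.
have apE v M x : coordinates e v M -> ap M x = val (v x).
  by move=> vM; apply/rowP => i; rewrite mxE vM.
have poly_in (p : {mpoly k[N]}) (sh : 'I_N -> 'I_(N + N)) (x : X) :
    exists q : {mpoly k[s]}, forall c : 'rV[k]_s, q.@[c ord0] =
      p.@[fun i => \sum_j c ord0 (mxvec_index (sh i) j) * e j x].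
  exists (p \mPo [tuple \sum_j e j x *: 'X_(mxvec_index (sh i) j) | i < N]) => c.
  rewrite comp_mpoly_meval; apply: meval_eq => i.
  rewrite tnth_map tnth_ord_tuple raddf_sum; apply: eq_bigr => j _ /=.
  by rewrite mevalZ mevalXU mulrC.
have polyA (p : {mpoly k[N]}) (x : X) : exists q : {mpoly k[s]}, forall c : 'rV[k]_s,
    q.@[c ord0] = p.@[ap (A c) x ord0].
  have [q qE] := poly_in p (@lshift N N) x; exists q => c; rewrite qE.
  by apply: meval_eq => i; rewrite mxE; apply: eq_bigr => j _; rewrite AE.
have polyB (p : {mpoly k[N]}) (x : X) : exists q : {mpoly k[s]}, forall c : 'rV[k]_s,
    q.@[c ord0] = p.@[ap (B c) x ord0].
  have [q qE] := poly_in p (@rshift N N) x; exists q => c; rewrite qE.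
  by apply: meval_eq => i; rewrite mxE; apply: eq_bigr => j _; rewrite BE.
have IX c : zero_locus I c -> (forall x, X (ap (A c) x)) /\ (forall x, X (ap (B c) x)).
  move=> Ic; split=> x; apply: (zariski_closedP Xc) => p pX.
    have [q qE] := polyA p x; rewrite -qE; apply: Ic => c' [v [_ vA _]].
    by rewrite qE (apE v) // pX //; exact: set_valP.
  have [q qE] := polyB p x; rewrite -qE; apply: Ic => c' [v [_ _ vB]].
  by rewrite qE (apE (v^-1)%g) // pX //; exact: set_valP.
have IBA c (x : X) i : zero_locus I c ->
    \sum_j B c i j * (E j).@[ap (A c) x ord0] = val x ord0 i.
  move=> Ic; have /choice [q qE] : forall j, exists q : {mpoly k[s]}, forall c : 'rV[k]_s,
      q.@[c ord0] = (E j).@[ap (A c) x ord0] by move=> j; exact: polyA.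
  pose Q : {mpoly k[s]} :=
    \sum_j 'X_(mxvec_index (rshift N i) j) * q j - (val x ord0 i)%:MP.
  have QE (c' : 'rV[k]_s) : Q.@[c' ord0] =
      \sum_j B c' i j * (E j).@[ap (A c') x ord0] - val x ord0 i.
    rewrite mevalB mevalC; congr (_ - _); rewrite raddf_sum.
    by apply: eq_bigr => j _ /=; rewrite mevalM mevalXU qE BE.
  apply/eqP; rewrite -subr_eq0 -QE; apply/eqP; apply: Ic => c' [v [_ vA vB]].
  rewrite QE; apply/eqP; rewrite subr_eq0; apply/eqP.
  have -> : val x = val ((v^-1)%g (v x)) by rewrite /= aut_funK.
  rewrite vB; apply: eq_bigr => j _; congr (_ * _).
  by rewrite (apE v) // (EP j).2.
have IAB c (x : X) i : zero_locus I c ->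
    \sum_j A c i j * (E j).@[ap (B c) x ord0] = val x ord0 i.
  move=> Ic; have /choice [q qE] : forall j, exists q : {mpoly k[s]}, forall c : 'rV[k]_s,
      q.@[c ord0] = (E j).@[ap (B c) x ord0] by move=> j; exact: polyB.
  pose Q : {mpoly k[s]} :=
    \sum_j 'X_(mxvec_index (lshift N i) j) * q j - (val x ord0 i)%:MP.
  have QE (c' : 'rV[k]_s) : Q.@[c' ord0] =
      \sum_j A c' i j * (E j).@[ap (B c') x ord0] - val x ord0 i.
    rewrite mevalB mevalC; congr (_ - _); rewrite raddf_sum.
    by apply: eq_bigr => j _ /=; rewrite mevalM mevalXU qE AE.
  apply/eqP; rewrite -subr_eq0 -QE; apply/eqP; apply: Ic => c' [v [_ vA vB]].
  rewrite QE; apply/eqP; rewrite subr_eq0; apply/eqP.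
  have -> : val x = val (v ((v^-1)%g x)) by rewrite /= aut_invK.
  rewrite vA; apply: eq_bigr => j _; congr (_ * _).
  by rewrite (apE (v^-1)%g) // (EP j).2.
have IC c : zero_locus I c -> C c.
  move=> Ic; have [XA XB] := IX c Ic.
  pose phi (x : X) : X := exist _ (ap (A c) x) (mem_set (XA x)).
  pose psi (x : X) : X := exist _ (ap (B c) x) (mem_set (XB x)).
  have phiK : cancel phi psi.
    move=> x; apply: val_inj; apply/rowP => i; rewrite -[RHS](IBA c x i Ic) [LHS]mxE.
    by apply: eq_bigr => j _; rewrite (EP j).2.
  have psiK : cancel psi phi.
    move=> x; apply: val_inj; apply/rowP => i; rewrite -[RHS](IAB c x i Ic) [LHS]mxE.
    by apply: eq_bigr => j _; rewrite (EP j).2.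
  have rep (M : 'M[k]_(N, m)) (f : X -> X) : (forall x, val (f x) = ap M x) ->
      degree_le d f.
    move=> fM; exists (fun i => \sum_j M i j *: E j) => [i|x i].
      apply: leq_trans (msize_sum _ _ _) _; apply/bigmax_leqP => j _.
      by apply: leq_trans (msizeZ_le _ _) _; exact: (EP j).1.
    rewrite fM mxE raddf_sum; apply: eq_bigr => j _ /=.
    by rewrite mevalZ (EP j).2.
  have phid : degree_le d phi by apply: rep.
  have psid : degree_le d psi by apply: rep.
  have phir : regular_map phi by have [P _ ?] := phid; exists P.
  have psir : regular_map psi by have [P _ ?] := psid; exists P.
  pose v : Aut := Defs.Aut phiK psiK phir psir.
  have vA : coordinates e v (A c) by move=> x i; rewrite [LHS]mxE.
  have vB : coordinates e (v^-1)%g (B c) by move=> x i; rewrite [LHS]mxE.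
  exists v; split=> //; apply/(SZ v (A c) (B c)) => //.
  rewrite cAB ZE => q Jq; apply: Ic => c' [w [Sw wA wB]].
  have : Z (mxvec (col_mx (A c') (B c'))) by apply/(SZ w) => //; exact: Sd.
  by rewrite cAB ZE; exact.
have /choice [u uP] : forall c, exists v, zero_locus I c ->
    [/\ S v, coordinates e v (A c) & coordinates e (v^-1)%g (B c)].
  move=> c; have [/IC [v vP]|] := pselect (zero_locus I c); first by exists v.
  by exists 1%g.
pose W (sh : 'I_N -> 'I_(N + N)) i : {mpoly k[s + N]} :=
  \sum_j 'X_(lshift N (mxvec_index (sh i) j)) *
    (E j \mPo [tuple 'X_(rshift s l) | l < N]).
have WE sh (c : 'rV[k]_s) (x : X) i : (W sh i).@[row_mx c (val x) ord0] =
    \sum_j c ord0 (mxvec_index (sh i) j) * e j x.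
  rewrite raddf_sum; apply: eq_bigr => j _ /=.
  rewrite mevalM mevalXU row_mxEl comp_mpoly_meval (EP j).2; congr (_ * _).
  by apply: meval_eq => l; rewrite tnth_map tnth_ord_tuple mevalXU row_mxEr.
exists s, I, u, (W (@lshift N N)), (W (@rshift N N)); split.
- apply/seteqP; split=> [v Sv|_ [c /uP [Sv _ _] <-] //].
  have [[P Pd Pv] [P' P'd P'v]] := Sd v Sv.
  have coef f Q : (forall i : 'I_N, (msize (Q i) <= d.+1)%N) -> represents Q f ->
      exists M : 'M[k]_(N, m), coordinates e f M.
    move=> Qd Qf; have /choice [b bP] : forall i, exists b : 'rV[k]_m,
        forall x : X, (Q i).@[val x ord0] = \sum_j b ord0 j * e j x.
      by move=> i; apply: espan; exists (Q i).
    by exists (\matrix_(i, j) b i ord0 j) => x i; rewrite Qf bP;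
       apply: eq_bigr => j _; rewrite mxE.
  have [M vM] := coef _ _ Pd Pv; have [M' vM'] := coef _ _ P'd P'v.
  pose c := mxvec (col_mx M M').
  have Ac : A c = M by rewrite /A /c mxvecK col_mxKu.
  have Bc : B c = M' by rewrite /B /c mxvecK col_mxKd.
  have Ic : zero_locus I c.
    by move=> p pI; apply: pI; exists v; rewrite Ac Bc.
  exists c => //; have [_ uA uB] := uP c Ic.
  apply: aut_eq; apply/funext => x; apply: val_inj; apply/rowP => i.
  by rewrite uA vM Ac.
- move=> c /uP [_ uA _] x i; rewrite uA WE.
  by apply: eq_bigr => j _; rewrite AE.
- move=> c /uP [_ _ uB] x i; rewrite uB WE.
  by apply: eq_bigr => j _; rewrite BE.
Qed.

Lemma values_parametrized (S : set Aut) (m : nat) (x : 'I_m -> X) :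
  parametrized S -> exists (s : nat) (I : set {mpoly k[s]})
    (F : 'I_(m * N) -> {mpoly k[s]}),
    forall y, [set values x f | f in S] y <-> exists2 c, zero_locus I c &
      forall l, y ord0 l = (F l).@[c ord0].
Proof.
move=> [s [I [u [U [U' [SE uU _]]]]]].
have /choice [F FE] : forall l, exists q : {mpoly k[s]}, forall c : 'rV[k]_s,
    zero_locus I c -> values x (u c) ord0 l = q.@[c ord0].
  move=> l; case/mxvec_indexP: l => i j.
  exists (U j \mPo [tuple match split l with
    | inl a => 'X_a | inr b => (val (x i) ord0 b)%:MP end | l < s + N]) => c Ic.
  rewrite valuesE uU // comp_mpoly_meval; apply: meval_eq => l.
  rewrite tnth_map tnth_ord_tuple; case: splitP => a la.
    by rewrite mevalXU (_ : l = lshift N a) ?row_mxEl //; exact: val_inj.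
  by rewrite mevalC (_ : l = rshift s a) ?row_mxEr //; exact: val_inj.
exists s, I, F => y; rewrite SE; split.
  by move=> [_ [c Ic <-] <-]; exists c => // l; exact: FE.
move=> [c Ic yE]; exists (u c); first by exists c.
by apply/rowP => l; rewrite FE.
Qed.

End Parametrization.

Section Closedness.
Variables (k : closedFieldType) (N : nat) (X : set 'rV[k]_N).
Local Notation Aut := (aut X).

Definition regfun_closure (S : set Aut) : set Aut :=
  [set f | forall a, regfun a /\ (forall g, S g -> a g = 0) -> a f = 0].

Lemma regfun_closure_subgroup (S : set Aut) :
  subgroup S -> subgroup (regfun_closure S).
Proof.
move=> [S1 SM SI].
(* Two passes: first left translation by elements of [S], then right translation by elements of the
   closure. *)
have SS f g : S f -> regfun_closure S g -> regfun_closure S (f * g)%g.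
  move=> Sf Sg a [ra aS]; apply: (Sg (fun g => a (f * g)%g)).
  by split; [exact: regfun_mull|move=> h Sh; apply: aS; exact: SM].
split.
- by move=> a [_]; apply.
- move=> f g Sf Sg a [ra aS]; apply: (Sf (fun f => a (f * g)%g)).
  split; first exact: regfun_mulr.
  by move=> h Sh; apply: (SS h g Sh Sg).
- move=> f Sf a [ra aS]; apply: (Sf (fun f => a (f^-1)%g)).
  by split; [exact: regfun_inv|move=> h Sh; apply: aS; exact: SI].
Qed.

Lemma sub_regfun_closure (S : set Aut) : S `<=` regfun_closure S.
Proof. by move=> f Sf a [_]; exact. Qed.

Variables (V : set Aut) (D : nat).
Hypotheses (V1 : V 1%g) (Virr : regfun_irreducible V) (Vp : parametrized V).
Local Notation Gamma := (subgroup_generated V).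
Hypothesis GD : Gamma `<=` aut_le D.

Lemma regfun_irreducible_generated : regfun_irreducible Gamma.
Proof.
rewrite subgroup_generated_word //; split; first by exists 1%g, 0%N.
move=> a b ra rb ab; apply: contrapT => /not_orP [].
move=> /existsNP [f /not_implyP [[m wf] af]] /existsNP [g /not_implyP [[n wg] bg]].
have [|H|H] := (regfun_irreducible_word (maxn m n) Virr).2 a b ra rb.
- by move=> h wh; apply: ab; exists (maxn m n).
- by apply: af; apply: H; apply: (word_le V1 _ wf); exact: leq_maxl.
- by apply: bg; apply: H; apply: (word_le V1 _ wg); exact: leq_maxr.
Qed.

Lemma regfun_closure_generated : regfun_closure Gamma `<=` Gamma.
Proof.
have Gs := subgroup_generated_subgroup V; have [G1 GM GI] := Gs.
have [C1 CM CI] := regfun_closure_subgroup Gs.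
have [r [x [t [_ _ tP]]]] := interpolation_aut X D.
(* Interpolation is a family of regular equations in [f]. It holds on [Gamma] by the degree bound,
   hence on its closure, whose elements are therefore determined by their values at the points
   [x l]. *)
have tC f : regfun_closure Gamma f -> forall (y : X) i,
    val (f y) ord0 i = \sum_l val (f (x l)) ord0 i * (t l).@[val y ord0].
  move=> Cf y i; apply/eqP; rewrite -subr_eq0; apply/eqP.
  pose a (f : Aut) := val (f y) ord0 i +
    \sum_l - (t l).@[val y ord0] * val (f (x l)) ord0 i.
  have aE g : a g = val (g y) ord0 i -
      \sum_l val (g (x l)) ord0 i * (t l).@[val y ord0].
    rewrite /a -sumrN; congr (_ + _); apply: eq_bigr => l _.
    by rewrite mulNr mulrC.
  rewrite -aE; apply: Cf; split.
    apply: regfunD; first exact: regfun_eval.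
    by apply: regfun_comb => l; exact: regfun_eval.
  by move=> g /GD gD; rewrite aE -tP // subrr.
have values_inj f g : regfun_closure Gamma f -> regfun_closure Gamma g ->
    values x f = values x g -> f = g.
  move=> Cf Cg fg; apply: aut_eq; apply/funext => y; apply: val_inj.
  apply/rowP => i; rewrite !tC //; apply: eq_bigr => l _.
  by rewrite -!valuesE fg.
pose S := [set values x f | f in Gamma].
have Sirr : irreducible_points S.
  exact: irreducible_values regfun_irreducible_generated.
have CS f : regfun_closure Gamma f -> closure_points S (values x f).
  move=> Cf q qS; apply: (Cf (fun f => q.@[values x f ord0])); split.
    exact: regfun_values.
  by move=> g Gg; apply: qS; exists g.
have wG f n : word V n f -> Gamma f.
  by move=> wf; rewrite subgroup_generated_word //; exists n.
have [s [I [F FP]]] := values_parametrized x (parametrized_word (r * N) Vp).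
have dense q : values_poly x q -> (forall f, word V (r * N) f -> q f = 0) ->
    forall f, Gamma f -> q f = 0.
  exact: (word_dense Virr V1).
case: (chevalley Sirr FP) => [[p npS pT]|[p npS pT]]; last first.
  (* The complement of the words cannot be generic, since the words of length [r * N] are dense. *)
  exfalso; apply: npS => _ [g Gg <-].
  apply: (dense (fun f => p.@[values x f ord0])) Gg; first by exists p.
  move=> f wf; apply: contrapT => pf.
  have Cf : regfun_closure Gamma f by apply: sub_regfun_closure; exact: wG wf.
  by apply: (pT _ (CS _ Cf) pf); exists f.
move=> g Cg.
(* Otherwise [f |-> p (values (g * f^-1))] vanishes on [Gamma], hence on its closure. At
   [f = h^-1 * g] with [h] in [Gamma] it is the value of [p] at [h], so [p] would vanish on all of
   [S]. *)
have [f Gf pf] : exists2 f, Gamma f & p.@[values x (g * f^-1)%g ord0] <> 0.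
  apply: contrapT => nf; apply: npS => _ [h Gh <-].
  have -> : h = (g * (h^-1 * g)^-1)%g by rewrite invgM invgK mulgA mulgV mul1g.
  have Chg : regfun_closure Gamma (h^-1 * g)%g.
    by apply: (CM) => //; apply: sub_regfun_closure; exact: GI.
  apply: (Chg (fun f => p.@[values x (g * f^-1)%g ord0])); split.
    exact: (regfun_inv (regfun_mull g (regfun_values x p))).
  by move=> f Gf; apply: contrapT => pf; apply: nf; exists f.
have Cgf : regfun_closure Gamma (g * f^-1)%g.
  by apply: (CM) => //; apply: sub_regfun_closure; exact: GI.
have [h wh hE] := pT _ (CS _ Cgf) pf.
have hg : h = (g * f^-1)%g.
  by apply: values_inj => //; apply: sub_regfun_closure; exact: wG wh.
have -> : g = (h * f)%g by rewrite hg -mulgA mulVg mulg1.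
by apply: GM => //; exact: wG wh.
Qed.

End Closedness.

Theorem theoremB (k : closedFieldType) (N : nat) (X : set 'rV[k]_N)
  (hX : zariski_closed X) (V : set (aut X)) :
  commutative_subset V ->
  irreducible_subset V ->
  algebraic_subset V ->
  V 1%g ->
  algebraic_subgroup (subgroup_generated V).
Proof.
move=> Vcomm /irreducible_regfun Virr [Vclosed [d Vd]] V1.
have [D GD] := subgroup_generated_aut_le Vcomm Virr V1 Vd hX.
have Vp := parametrized_closed hX (Vclosed d) Vd.
have GE : subgroup_generated V = regfun_closure (subgroup_generated V).
  apply/seteqP; split; first exact: sub_regfun_closure.
  exact: (regfun_closure_generated V1 Virr Vp GD).
split; first exact: subgroup_generated_subgroup.
split; last by exists D.
by rewrite GE; apply: regfun_zeros_closed => a [].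
Qed.
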